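(* The following statements are equivalent for a positive integer $n$. (1) The integer $n$ is a divisor of $12$. (2) The group $\mathrm{Hol}(\mathbf{Z}_n)$ is isomorphic to the group of units of a finite ring. (3) The unit group of the polynomial ring $\mathbf{Z}_n[x]$ is an elementary abelian $2$-group. (4) The group $\mathrm{Hol}(\mathbf{Z}_n)$ is isomorphic to a direct product of dihedral groups. (5) The order of $\mathrm{Hol}(\mathbf{Z}_n)$ is a divisor of $48$.
   Context: Rings are associative with identity, not necessarily commutative; the zero ring is allowed. $\mathbf{Z}_n$ is the cyclic group (or ring) of integers modulo $n$. $\mathrm{Hol}(\mathbf{Z}_n) = \mathbf{Z}_n \rtimes \mathrm{Aut}(\mathbf{Z}_n) = \mathbf{Z}_n \rtimes \mathbf{Z}_n^\times$ is the holomorph, i.e. the group of maps $x \mapsto ax+b$ on $\mathbf{Z}_n$ with $a \in \mathbf{Z}_n^\times$, $b\in \mathbf{Z}_n$. Dihedral groups are the groups $D_{2k}$ of order $2k$, $k \ge 1$, including $D_2 \cong C_2$ and $D_4 \cong C_2 \times C_2$. Direct products are finite, and the empty product (the trivial group) is allowed. An elementary abelian $2$-group is an abelian group in which every element squares to the identity (the trivial group is allowed, and the group may be infinite). *)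

(* Defs.v *)
From HB Require Import structures.
From mathcomp Require Import all_boot all_order all_fingroup all_algebra.
From mathcomp Require Import all_solvable.

Set Implicit Arguments.
Unset Strict Implicit.
Unset Printing Implicit Defensive.

Import GRing.Theory.

Section Units.
Local Open Scope ring_scope.
Variable R : pzRingType.

(* Units are encoded as pairs of mutually inverse elements, so that the unit
   group makes sense in every ring, the zero ring included (unlike {unit _}). *)
Record units := Units {
  unit_pair : R * R;
  _ : (unit_pair.1 * unit_pair.2 == 1) && (unit_pair.2 * unit_pair.1 == 1) }.

HB.instance Definition _ := [isSub for unit_pair].
HB.instance Definition _ := [Choice of units by <:].

Lemma unitsP (u : units) :
  (val u).1 * (val u).2 = 1 /\ (val u).2 * (val u).1 = 1.
Proof. by case: u => p /= /andP[/eqP ? /eqP ?]. Qed.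

Fact units_one_proof : ((1 : R) * 1 == 1) && ((1 : R) * 1 == 1).
Proof. by rewrite mulr1 eqxx. Qed.

Definition units_one : units := @Units (1, 1) units_one_proof.

Fact units_mul_proof (u v : units)
    (w := ((val u).1 * (val v).1, (val v).2 * (val u).2)) :
  (w.1 * w.2 == 1) && (w.2 * w.1 == 1).
Proof.
have [u1 u2] := unitsP u; have [v1 v2] := unitsP v.
rewrite /w /= -mulrA [X in _ * X]mulrA v1 mul1r u1 eqxx /=.
by rewrite -mulrA [X in _ * X]mulrA u2 mul1r v2.
Qed.

Definition units_mul (u v : units) : units := Units (units_mul_proof u v).

Fact units_inv_proof (u : units) (w := ((val u).2, (val u).1)) :
  (w.1 * w.2 == 1) && (w.2 * w.1 == 1).
Proof. by have [u1 u2] := unitsP u; rewrite /w /= u1 u2 eqxx. Qed.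

Definition units_inv (u : units) : units := Units (units_inv_proof u).

Lemma units_mulA : associative units_mul.
Proof. by move=> u v w; apply: val_inj; rewrite /= !mulrA. Qed.

Lemma units_mul1g : left_id units_one units_mul.
Proof. by move=> [[a b] p]; apply: val_inj; rewrite /= mul1r mulr1. Qed.

Lemma units_mulg1 : right_id units_one units_mul.
Proof. by move=> [[a b] p]; apply: val_inj; rewrite /= mul1r mulr1. Qed.

Lemma units_mulVg : left_inverse units_one units_inv units_mul.
Proof. by move=> u; apply: val_inj; rewrite /= (unitsP u).2. Qed.

Lemma units_mulgV : right_inverse units_one units_inv units_mul.
Proof. by move=> u; apply: val_inj; rewrite /= (unitsP u).1. Qed.

HB.instance Definition _ := isGroup.Build units
  units_mulA units_mul1g units_mulg1 units_mulVg units_mulgV.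

End Units.

HB.instance Definition _ (R : finPzRingType) := [Finite of units R by <:].

Definition elementary_abelian2 (G : groupType) : Prop :=
  (forall x y : G, x * y = y * x)%g /\ (forall x : G, x * x = 1)%g.

(* The polynomial ring Z_n[x].  Since 'Z_1 is not the zero ring, and {poly _}
   needs nonzero coefficient rings, the case n = 1 is set apart: Z_1[x] is the
   zero ring, given here as the ring of 0 x 0 matrices.  Junk for n = 0. *)
Definition polyZmod (n : nat) : pzRingType :=
  if n == 1 then ('M[int]_0 : pzRingType) else ({poly 'Z_n} : pzRingType).

Definition Hol (gT : finGroupType) (G : {group gT}) :
    {group sdprod_by [Aut G]%gact} :=
  [set: sdprod_by [Aut G]%gact]%G.

(* Zp n is cyclic of order n for every n > 0; in particular Zp 1 is trivial,
   although the type 'Z_1 has two elements. *)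
Definition HolZ (n : nat) := Hol (Zp_group n).

(* The dihedral group of order 2k, for k > 0.  The library's 'D_m is only
   meaningful for even m >= 4. *)
Definition dihedral (k : nat) : finGroupType :=
  if k == 1 then ('Z_2 : finGroupType) else 'D_k.*2.

(* Main.v *)
(* For (2) => (1), let t be the unit of the finite ring R corresponding to the
   translation by 1. It has order n, every unit commuting with t is a power of t,
   and some unit conjugates t to its inverse. So in the commutative ring S of
   elements commuting with the whole centralizer of t, the unit group is cyclic of
   order n, and conjugation induces an endomorphism of S inverting every unit; a
   unit fixed by it squares to 1. Applied to integers this gives 12 = 0 in S, and
   applied to units such as s^-1 + 1 + s, where s is a power of t, it forces
   s^3 = 1 for the odd part s of t and excludes elements of order 8.

   For (4) => (1), if x^y = x^a in a dihedral group then y^2 centralizes x, and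
   x^8 = 1, x^y = x^5 imply x^4 = 1. These implications pass to direct products;
   in Hol(Z_n) the first gives a^2 = 1 mod n for all a prime to n, so n divides
   24, and the second excludes 8 | n. For (3) => (1), constants give n | 24 in the
   same way, and 1 + 6 x is then a unit of Z_n[x] with square 1 + 12 x + 36 x^2.

   In the other direction, Hol(Z_n) is D_{2n} when phi(n) = 2 and
   Hol(Z_12) = D_8 x D_6, while D_6 is the unit group of M_2(F_2) and D_8 that of
   the upper triangular 3 x 3 matrices over F_2 with constant diagonal. *)

From HB Require Import structures.
Require Import Defs.
From mathcomp Require Import all_boot all_order all_fingroup all_algebra.
From mathcomp Require Import all_solvable ring zify.

Set Implicit Arguments.
Unset Strict Implicit.
Unset Printing Implicit Defensive.

Import GRing.Theory.

(** * Arithmetic and commutative rings *)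

(** By the Chinese remainder theorem some [a] is 1 modulo the 2-part and 2 modulo the odd part, so
    the odd part divides 2^2 - 1; another is 3 and 1 respectively, so the 2-part divides 3^2 - 1. *)
Lemma dvdn24_of_sqr_mod n : 0 < n ->
  (forall a, coprime a n -> a ^ 2 = 1 %[mod n]) -> n %| 24.
Proof.
move=> n_gt0 sq1; set b := n`_2; set m := n`_2^'.
have Dn : n = b * m by rewrite partnC.
have b_dvd : b %| n by exact: dvdn_part.
have m_dvd : m %| n by exact: dvdn_part.
have co_bm : coprime b m by exact: coprime_partC.
have odd_m : odd m by rewrite -coprime2n -(coprime_pexpl _ _ (isT : 0 < 1)) expn1;
  exact: (pnat_coprime (pnat_id _) (part_pnat _ _)).
have co_3b : coprime 3 b.
  by rewrite /b p_part coprimeXr.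
have chin x y : exists a, a = x %[mod b] /\ a = y %[mod m].
  by exists (chinese b m x y); rewrite chinese_modl ?chinese_modr.
have cop a x y : a = x %[mod b] -> a = y %[mod m] ->
    coprime x b -> coprime y m -> coprime a n.
  move=> ax ay cx cy; rewrite Dn coprimeMr -[coprime a b]coprime_modl ax.
  by rewrite coprime_modl cx -coprime_modl ay coprime_modl.
have m_dvd3 : m %| 3.
  have [a [a1 a2]] := chin 1 2.
  have /sq1 : coprime a n by apply: cop a1 a2 _ _; rewrite ?coprime1n ?coprime2n.
  move=> /(congr1 (modn^~ m)); rewrite !modn_dvdm // => /eqP.
  rewrite -modnXm a2 modnXm eqn_mod_dvd //.
have b_dvd8 : b %| 8.
  have [a [a1 a2]] := chin 3 1.
  have /sq1 : coprime a n by apply: cop a1 a2 _ _; rewrite ?coprime1n.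
  move=> /(congr1 (modn^~ b)); rewrite !modn_dvdm // => /eqP.
  rewrite -modnXm a1 modnXm eqn_mod_dvd //.
by rewrite Dn (_ : 24 = 8 * 3) // dvdn_mul.
Qed.

Lemma dvdn12_of_dvdn24 n : n %| 24 -> ~~ (8 %| n) -> n %| 12.
Proof.
rewrite dvdn_divisors // => n24 n8; apply: contraNT n8; move: n24.
by rewrite !inE; repeat (case/predU1P => [->|] //); move/eqP->.
Qed.

Section InvertedUnits.
Local Open Scope ring_scope.
(** Used with [z] an explicit combination of quantities known to vanish: [ring] checks the
    polynomial identity, and rewriting then kills [z]. *)
Lemma eq_of_sub (V : zmodType) (x y z : V) : x - y = z -> z = 0 -> x = y.
Proof. by move=> <- /eqP; rewrite subr_eq0 => /eqP. Qed.

Section CommutativeRing.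

Variable S : comPzRingType.

(** By Bezout [x] is a power of [x ^+ q]. For [e] an idempotent this extracts a [q]-th root of
    [x ^+ q = 1] on the component of [e]. *)
Lemma fix_of_fixX (e x : S) q m :
  x ^+ m = 1 -> coprime q m -> (0 < q)%N -> e * x ^+ q = e -> e * x = e.
Proof.
move=> xm co q_gt0 exq; case: (egcdnP m q_gt0) => a b Dab _.
have exqj j : e * x ^+ (q * j) = e.
  by elim: j => [|j IH]; rewrite ?muln0 ?mulr1 // mulnS exprD mulrA exq.
move: Dab; rewrite (eqP co) => Dab.
by rewrite -{2}(exqj a) mulnC Dab exprD mulnC exprM xm expr1n mul1r expr1.
Qed.

(* If [k * a = b * (d * m) + 1], multiplying by the sum of the [z ^+ (k * i)],
   [i < a], gives a geometric sum of length [b * (d * m) + 1]. *)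
Lemma geometric_unit (z : S) m d k : z ^+ m = 1 -> (0 < k)%N ->
    coprime k (d * m) ->
  exists X Y, (\sum_(i < k) z ^+ i) * X = 1 + d%:R * Y.
Proof.
move=> zm k_gt0 co; pose g j := \sum_(i < j) z ^+ i.
have gD a b : g (a + b)%N = g a + z ^+ a * g b.
  rewrite /g big_split_ord /= mulr_sumr; congr (_ + _).
  by apply: eq_bigr => i _; rewrite exprD.
have gM j : g (k * j)%N = g k * \sum_(i < j) z ^+ (k * i).
  elim: j => [|j IH]; first by rewrite muln0 /g !big_ord0 mulr0.
  by rewrite mulnSr gD IH big_ord_recr /= mulrDr [_ * g k]mulrC.
have gm j : g (m * j)%N = g m * j%:R.
  elim: j => [|j IH]; first by rewrite muln0 /g !big_ord0 mulr0.
  by rewrite mulnSr gD IH exprM zm expr1n mul1r mulrSr mulrDr mulr1.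
case: (egcdnP (d * m) k_gt0) => a b Dab _.
exists (\sum_(i < a) z ^+ (k * i)), (b%:R * z * g m).
move: Dab; rewrite (eqP co) -/(g k) -gM mulnC addnC => ->.
rewrite gD {1}/g big_ord1 expr0 expr1 (_ : (b * _ = m * (d * b))%N); last by lia.
by rewrite gm natrM; ring.
Qed.

End CommutativeRing.

(** * Commutative rings whose cyclic unit group is inverted by an endomorphism *)

Section InvertedCyclicUnits.

Variables (S : comPzRingType) (sg : {rmorphism S -> S}) (t ti : S) (n c : nat).
Hypotheses (n_gt0 : (0 < n)%N) (c_gt0 : (0 < c)%N) (c0 : c%:R = 0 :> S).
Hypotheses (tti : t * ti = 1) (sgt : sg t = ti).
Hypothesis order_t : forall j, t ^+ j = 1 <-> (n %| j)%N.
Hypothesis units_t : forall u v : S, u * v = 1 -> exists j, u = t ^+ j.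

Lemma symmetric_unit_sqr (u v : S) : u * v = 1 -> sg u = u -> u ^+ 2 = 1.
Proof.
move=> /units_t[j ->]; rewrite rmorphXn sgt /= expr2 => {1}<-.
by rewrite -exprMn mulrC tti expr1n.
Qed.

Lemma involution_unique (u v : S) : u ^+ 2 = 1 -> v ^+ 2 = 1 ->
  [\/ u = 1, v = 1 | u = v].
Proof.
move=> u2 v2; have /units_t[j Du] : u * u = 1 by rewrite -expr2.
have /units_t[k Dv] : v * v = 1 by rewrite -expr2.
move: (u2) (v2); rewrite Du Dv -!exprM => /order_t j2 /order_t k2.
have [/order_t ->|nj] := boolP (n %| j)%N; first by constructor 1.
have [/order_t ->|nk] := boolP (n %| k)%N; first by constructor 2.
(* Neither [j] nor [k] is a multiple of [n] but their doubles are, so both doubles are odd multiples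
   of [n] and their sum is an even one. *)
constructor 3; have /order_t : (n %| j + k)%N.
  have half x a : (x * 2 = a * n)%N -> ~~ odd a -> (n %| x)%N.
    move=> Da ea; apply/dvdnP; exists a./2; apply/eqP.
    by rewrite -(eqn_pmul2r (isT : (0 < 2)%N)) Da mulnAC muln2 even_halfK.
  case/dvdnP: j2 => a Da; case/dvdnP: k2 => b Db.
  apply: (half _ (a + b)%N); rewrite ?mulnDl ?Da ?Db // oddD.
  have -> : odd a by apply: contraR nj => /(half _ _ Da).
  by have -> : odd b by apply: contraR nk => /(half _ _ Db).
by rewrite exprD => jk; rewrite -[LHS]mulr1 -{1}v2 Dv expr2 mulrA jk mul1r.
Qed.

(** Integers are fixed by [sg], so those prime to the characteristic [d] square to 1 and [d] divides
    24. Then 5 and 7 both square to 1, and a cyclic group has at most one involution. *)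
Lemma char12 : 12%:R = 0 :> S.
Proof.
have ex_c : exists d, (0 < d)%N && (d%:R == 0 :> S).
  by exists c; rewrite c_gt0 c0 /=.
case: (ex_minnP ex_c) => d /andP[d_gt0 /eqP d0] d_min.
have char_d k : k%:R = 0 :> S -> (d %| k)%N.
  move=> k0; rewrite /dvdn; case: posnP => // r_gt0.
  suff /d_min : (0 < k %% d)%N && ((k %% d)%:R == 0 :> S).
    by rewrite leqNgt ltn_mod d_gt0.
  rewrite r_gt0; move: k0; rewrite {1}(divn_eq k d) natrD natrM d0 mulr0 add0r.
  by move->; rewrite eqxx.
have sq1 a : coprime a d -> a%:R ^+ 2 = 1 :> S.
  case: (posnP a) => [->|a_gt0].
    rewrite /coprime gcd0n => /eqP d1; move: d0; rewrite d1 mulr1n => S1.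
    by rewrite -[RHS]mulr1 S1 mulr0 expr2 mul0r.
  move=> co; case: (egcdnP d a_gt0) => p q Dpq _.
  apply: (@symmetric_unit_sqr _ p%:R); last by rewrite rmorph_nat.
  by rewrite -natrM mulnC Dpq (eqP co) natrD natrM d0 mulr0 add0r.
have sq_mod a : coprime a d -> (a ^ 2 = 1 %[mod d])%N.
  case: (posnP a) => [->|a_gt0];
    first by rewrite /coprime gcd0n => /eqP->; rewrite !modn1.
  move=> /sq1 a2; apply/eqP; rewrite eqn_mod_dvd ?expn_gt0 ?a_gt0 //.
  by apply: char_d; rewrite natrB ?expn_gt0 ?a_gt0 // natrX a2 subrr.
have /dvdnP[e De] := dvdn24_of_sqr_mod d_gt0 sq_mod.
have h24 : 24%:R = 0 :> S by rewrite De natrM d0 mulr0.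
have i5 : 5%:R ^+ 2 = 1 :> S by apply: (eq_of_sub (z := 24%:R)) => //; ring.
have i7 : 7%:R ^+ 2 = 1 :> S.
  by apply: (eq_of_sub (z := 2%:R * 24%:R)); [ring | rewrite h24 mulr0].
(* The three cases make 4, 6 and 2 vanish respectively, and each of these divides 12. *)
case: (involution_unique i5 i7) => h.
- have -> : 12%:R = 3%:R * (5%:R - 1) :> S by ring.
  by rewrite h subrr mulr0.
- have -> : 12%:R = 2%:R * (7%:R - 1) :> S by ring.
  by rewrite h subrr mulr0.
- have -> : 12%:R = 6%:R * (7%:R - 5%:R) :> S by ring.
  by rewrite h subrr mulr0.
Qed.

Let h12 := char12.

(* Since 12 = 0, the idempotents 4 and 9 split [S] into rings of characteristic
   dividing 3 and 4. *)
Lemma odd_part3 (s si : S) m : s * si = 1 -> sg s = si -> sg si = s ->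
  s ^+ m = 1 -> odd m -> 4%:R * s ^+ 3 = 4%:R.
Proof.
move=> ssi sgs sgsi sm om.
have s2m : (s ^+ 2) ^+ m = 1 by rewrite -exprM mulnC exprM sm expr1n.
have [X [Y]] : exists X Y, (\sum_(i < 2) (s ^+ 2) ^+ i) * X = 1 + 3%:R * Y.
  by apply: geometric_unit s2m _ _; rewrite ?coprimeMr ?coprime2n.
rewrite !big_ord_recr big_ord0 /= add0r expr0 expr1 => g2.
set w := s + si.
have wX : 4%:R * (w * (s * X)) = 4%:R.
  apply: (eq_of_sub (z := 4%:R * (s ^+2 * X + (s * si) * X - (1 + 3%:R * Y))
      + 12%:R * Y)).
    by rewrite /w; ring.
  by rewrite ssi -g2 h12; ring.
(* This unit is [w] on the component of 4 and 1 on that of 9. There [w] is invertible, because 1 +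
   s^2 is, by the geometric sum. *)
have U2 : (9%:R + 4%:R * w) ^+ 2 = 1.
  apply: (@symmetric_unit_sqr _ (9%:R + 4%:R * (s * X))).
    apply: (eq_of_sub (z := 4%:R * (4%:R * (w * (s * X)) - 4%:R)
       + 12%:R * (8%:R + 3%:R * w + 3%:R * (s * X)))); first by ring.
    by rewrite wX h12; ring.
  by rewrite rmorphD rmorphM !rmorph_nat rmorphD sgs sgsi /w [si + s]addrC.
have w2 : 4%:R * w ^+ 2 = 4%:R.
  apply: (eq_of_sub (z := ((9%:R + 4%:R * w) ^+ 2 - 1)
    - 12%:R * (w ^+ 2 + 6%:R * w + 7%:R))); first by ring.
  by rewrite U2 h12; ring.
have s4 : 4%:R * (s ^+ 2 + 1) ^+ 2 = 4%:R * s ^+ 2.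
  have -> : s ^+ 2 + 1 = s * w by rewrite /w mulrDr ssi expr2.
  by rewrite exprMn mulrCA w2 mulrC.
(* On the component of 4 the relation reads s^4 + s^2 + 1 = 0, so s^6 = 1, and the order of [s] is
   odd. *)
apply: (fix_of_fixX (q := 2) (m := m)); rewrite ?coprime2n //.
  by rewrite exprAC sm expr1n.
apply: (eq_of_sub
  (z := (s ^+ 2 - 1) * (4%:R * (s ^+ 2 + 1) ^+ 2 - 4%:R * s ^+ 2))).
  by ring.
by rewrite s4 subrr mulr0.
Qed.

(** Modulo 2, [y ^+ 2 * Q] is y^8 = x^8 - 1, and [K] is half the difference. On the component of 9,
    where 4 = 0, the vanishing of [Q] gives 2 x^8 = 2, so 2 x = 2 since the order is odd; then 2 y =
    0, which leaves x^8 = 1 and so x = 1. *)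
Lemma odd_part2 (x : S) m : x ^+ m = 1 -> odd m ->
  9%:R * ((x ^+ 2 - 1) * (x ^+ 4 - 1)) = 0 -> 9%:R * x = 9%:R.
Proof.
move=> xm om.
have co8 : coprime 8 m by rewrite (@coprime_pexpl 3 2) ?coprime2n.
pose y := x - 1; pose Q := (x ^+ 2 - 1) * (x ^+ 4 - 1).
pose K := y ^+ 6 + 7%:R * y ^+ 5 + 20%:R * y ^+ 4 + 31%:R * y ^+ 3
          + 28%:R * y ^+ 2 + 14%:R * y + 4%:R.
have Dx8 : x ^+ 8 = 1 + y ^+ 2 * Q + 2%:R * (y * K) by rewrite /K /Q /y; ring.
move=> Q0.
have x6 : 6%:R * x = 6%:R.
  apply: (fix_of_fixX (q := 8) xm) => //.
  apply: (eq_of_sub (z := 2%:R * y ^+ 2 * (9%:R * Q)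
    + 12%:R * (y * K - y ^+ 2 * Q))); first by rewrite Dx8; ring.
  by rewrite Q0 h12; ring.
have y6 : 6%:R * y = 0 by rewrite /y mulrBr x6 mulr1 subrr.
apply: (fix_of_fixX (q := 8) xm) => //.
apply: (eq_of_sub (z := y ^+ 2 * (9%:R * Q) + 3%:R * K * (6%:R * y))).
  by rewrite Dx8; ring.
by rewrite Q0 y6; ring.
Qed.

(* A unit symmetric under inversion, such as s^-2 + s^-1 + 1 + s + s^2, must
   square to 1. *)
Lemma odd_part2_coprime5 (s si : S) m : s * si = 1 -> sg s = si -> sg si = s ->
  s ^+ m = 1 -> odd m -> coprime 5 m -> 9%:R * s ^+ 3 = 9%:R.
Proof.
move=> ssi sgs sgsi sm om co5.
have [X [Y]] : exists X Y, (\sum_(i < 5) s ^+ i) * X = 1 + 4%:R * Y.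
  by apply: geometric_unit sm _ _; rewrite ?coprimeMr.
rewrite !big_ord_recr big_ord0 /= add0r expr0 expr1.
set g := _ + s ^+ 4 => gX.
set v := si ^+ 2 + si + 1 + s + s ^+ 2.
have Dg : g = s ^+ 2 * v by rewrite /g /v; ring: ssi.
have U2 : (4%:R + 9%:R * v) ^+ 2 = 1.
  apply: (@symmetric_unit_sqr _ (4%:R + 9%:R * (s ^+ 2 * X))).
    apply: (eq_of_sub (z := 81%:R * (g * X - (1 + 4%:R * Y))
      + 12%:R * (8%:R + 27%:R * Y + 3%:R * v + 3%:R * (s ^+ 2 * X)))).
      by rewrite Dg; ring.
    by rewrite gX h12; ring.
  by rewrite rmorphD rmorphM !rmorph_nat !rmorphD !rmorphXn sgs sgsi rmorph1 /v; ring.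
have v2 : 9%:R * v ^+ 2 = 9%:R.
  apply: (eq_of_sub (z := ((4%:R + 9%:R * v) ^+ 2 - 1)
    - 12%:R * (6%:R * v ^+ 2 + 6%:R * v + 2%:R))); first by ring.
  by rewrite U2 h12; ring.
have s3m : (s ^+ 3) ^+ m = 1 by rewrite exprAC sm expr1n.
apply: (odd_part2 s3m om).
have Dv : s ^+ 5 - 1 = (s - 1) * (s ^+ 2 * v) by rewrite -Dg /g; ring.
(* As v^2 = 1 on the component of 9, the squares of s^5 - 1 and of (s - 1) s^2 agree there; their
   difference factors as shown. *)
have Q0 : 9%:R * ((s ^+ 4 - 1) * (s ^+ 6 - 1)) = 0.
  apply: (eq_of_sub (z := (s - 1) ^+ 2 * s ^+ 4 * (9%:R * v ^+ 2 - 9%:R)));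
    last by rewrite v2 subrr mulr0.
  have -> : (s - 1) ^+ 2 * s ^+ 4 * (9%:R * v ^+ 2 - 9%:R) =
    9%:R * ((s ^+ 5 - 1) ^+ 2 - (s - 1) ^+ 2 * s ^+ 4) by rewrite Dv; ring.
  by ring.
have -> : 9%:R * (((s ^+ 3) ^+ 2 - 1) * ((s ^+ 3) ^+ 4 - 1)) =
  (s ^+ 8 + s ^+ 4 + 1) * (9%:R * ((s ^+ 4 - 1) * (s ^+ 6 - 1))) by ring.
by rewrite Q0 mulr0.
Qed.

(** For order 5 the five-term sum need not be invertible, but the three-term sum s^-1 + 1 + s is, on
    the component of 9. Its square being 1 gives the hypothesis of [odd_part2] for [s] itself. *)
Lemma odd_part2_order5 (s si : S) : s * si = 1 -> sg s = si -> sg si = s ->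
  s ^+ 5 = 1 -> 9%:R * s = 9%:R.
Proof.
move=> ssi sgs sgsi s5.
have [X [Y]] : exists X Y, (\sum_(i < 3) s ^+ i) * X = 1 + 4%:R * Y.
  by apply: geometric_unit s5 _ _; rewrite ?coprimeMr.
rewrite !big_ord_recr big_ord0 /= add0r expr0 expr1.
set g := _ + s ^+ 2 => gX.
set v := si + 1 + s.
have Dg : g = s * v by rewrite /g /v; ring: ssi.
have U2 : (4%:R + 9%:R * v) ^+ 2 = 1.
  apply: (@symmetric_unit_sqr _ (4%:R + 9%:R * (s * X))).
    apply: (eq_of_sub (z := 81%:R * (g * X - (1 + 4%:R * Y))
      + 12%:R * (8%:R + 27%:R * Y + 3%:R * v + 3%:R * (s * X)))).
      by rewrite Dg; ring.
    by rewrite gX h12; ring.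
  by rewrite rmorphD rmorphM !rmorph_nat !rmorphD sgs sgsi rmorph1 /v; ring.
have v2 : 9%:R * v ^+ 2 = 9%:R.
  apply: (eq_of_sub (z := ((4%:R + 9%:R * v) ^+ 2 - 1)
    - 12%:R * (6%:R * v ^+ 2 + 6%:R * v + 2%:R))); first by ring.
  by rewrite U2 h12; ring.
apply: (odd_part2 s5) => //.
have Dv : s ^+ 3 - 1 = (s - 1) * (s * v) by rewrite -Dg /g; ring.
apply: (eq_of_sub (z := (s - 1) ^+ 2 * s ^+ 2 * (9%:R * v ^+ 2 - 9%:R)));
  last by rewrite v2 subrr mulr0.
have -> : (s - 1) ^+ 2 * s ^+ 2 * (9%:R * v ^+ 2 - 9%:R) =
  9%:R * ((s ^+ 3 - 1) ^+ 2 - (s - 1) ^+ 2 * s ^+ 2) by rewrite Dv; ring.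
by ring.
Qed.

Lemma sgtX j : sg (t ^+ j) = ti ^+ j.
Proof. by rewrite rmorphXn sgt. Qed.

Lemma sgti : sg ti = t.
Proof.
have : ti * sg ti = 1 by rewrite -{1}sgt -rmorphM tti rmorph1.
by move=> h; rewrite -[LHS]mul1r -tti -mulrA h mulr1.
Qed.

(** If [r] has order 8, then r^4 is the only involution, so 5 and then -1 must each be 1 or r^4.
    Units built from the symmetric element r + r^-1 have to square to 1, which gives 4 = 0 and then
    a contradiction for both values of -1. *)
Lemma not_8_dvd : ~~ (8 %| n)%N.
Proof.
apply/negP => /dvdnP[q Dn].
pose r := t ^+ q; pose ri := ti ^+ q.
have rri : r * ri = 1 by rewrite -exprMn tti expr1n.
have r8 : r ^+ 8 = 1 by rewrite -exprM; apply/order_t; rewrite Dn.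
have r4 : r ^+ 4 <> 1.
  rewrite -exprM => /order_t; rewrite Dn => /dvdn_leq; lia.
have sgr : sg r = ri by rewrite sgtX.
have sgri : sg ri = r by rewrite rmorphXn sgti.
have invol u : u ^+ 2 = 1 -> u <> 1 -> u = r ^+ 4.
  move=> u2 u1; have r42 : (r ^+ 4) ^+ 2 = 1 by rewrite -exprM.
  by case: (involution_unique u2 r42).
have ri4 : ri ^+ 4 = r ^+ 4 by rewrite -[LHS]mulr1 -r8; ring: rri.
set w := r + ri.
have sgw : sg w = w by rewrite rmorphD sgr sgri addrC.
have h4 : 4%:R = 0 :> S.
  have i5 : 5%:R ^+ 2 = 1 :> S.
    by apply: (eq_of_sub (z := 2%:R * 12%:R)); [ring | rewrite h12 mulr0].
  case: (eqVneq (5%:R : S) 1) => [h5|/eqP/(invol _ i5) D5].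
    by apply: (eq_of_sub (z := 5%:R - 1)); [ring | rewrite h5 subrr].
  (* If 5 = r^4, the symmetric element 9 + 4 w has square 5, so it is a unit and 5 = 1, against r^4
     <> 1. *)
  have w2 : 4%:R * w ^+ 2 = 8%:R.
    have -> : 4%:R * w ^+ 2 = 8%:R + 4%:R * ri ^+ 2 * (1 + r ^+ 4).
      by rewrite /w; ring: rri.
    have -> : 4%:R * ri ^+ 2 * (1 + r ^+ 4) = 2%:R * ri ^+ 2 * 12%:R.
      by rewrite -D5; ring.
    by rewrite h12 mulr0 addr0.
  have U2 : (9%:R + 4%:R * w) ^+ 2 = 5%:R.
    apply: (eq_of_sub (z := 4%:R * (4%:R * w ^+ 2 - 8%:R)
      + 12%:R * (9%:R + 6%:R * w))); first by ring.
    by rewrite w2 h12; ring.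
  have : (9%:R + 4%:R * w) ^+ 2 = 1.
    apply: (@symmetric_unit_sqr _ (5%:R * (9%:R + 4%:R * w))).
      by rewrite mulrCA -expr2 U2 -expr2.
    by rewrite rmorphD rmorphM !rmorph_nat sgw.
  by rewrite U2 D5 => /r4.
have sgv : sg (1 + w) = 1 + w by rewrite rmorphD rmorph1 sgw.
have w2 : w ^+ 2 = r ^+ 2 + ri ^+ 2 + 2%:R by rewrite /w; ring: rri.
have m1 : (-1) ^+ 2 = 1 :> S by ring.
(* If -1 = 1, the characteristic divides 2 and w^4 = 0, so 1 + w is a symmetric unit; its square
   being 1 means r^2 + r^-2 = 0, that is r^4 = 1. *)
case: (eqVneq (-1 : S) 1) => [h|/eqP/(invol _ m1) D].
  have h2 : 2%:R = 0 :> S.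
    by apply: (eq_of_sub (z := 1 - -1)); [ring | rewrite h subrr].
  have w4 : w ^+ 4 = 0.
    apply: (eq_of_sub (z := 2%:R * (2%:R * w ^+ 2 - 1 + r ^+ 4))).
      by rewrite /w; ring: rri ri4.
    by rewrite h2 mul0r.
  have v2 : (1 + w) ^+ 2 = 1.
    apply: (@symmetric_unit_sqr _ ((1 + w) ^+ 3)) => //.
    rewrite -exprS; apply: (eq_of_sub (z :=
        w ^+ 4 + 2%:R * (2%:R * w + 3%:R * w ^+ 2 + 2%:R * w ^+ 3))).
      by ring.
    by rewrite w4 h2; ring.
  apply: r4; apply: (eq_of_sub (z := r ^+ 2 * ((1 + w) ^+ 2 - 1)
     - 2%:R * (r ^+ 2 * w + r ^+ 2 + 1))); first by rewrite /w; ring: rri.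
  by rewrite v2 h2; ring.
(* If -1 = r^4, then w^2 = 2 and 1 + w is a symmetric unit with square 3 + 2 w. Equating this to 1
   gives 2 (1 + w) = 0, hence 2 = 2 (1 + w)^2 = 0 and -1 = 1 after all. *)
have ri2 : ri ^+ 2 = - r ^+ 2.
  by rewrite -[RHS]mulN1r D -[LHS]mulr1 -r8; ring: rri.
have v2 : (1 + w) ^+ 2 = 3%:R + 2%:R * w.
  by apply: (eq_of_sub (z := w ^+ 2 - 2%:R)); [ring | rewrite w2 ri2; ring].
have : (1 + w) ^+ 2 = 1.
  apply: (@symmetric_unit_sqr _ ((1 + w) * (3%:R + 2%:R * w))) => //.
  rewrite mulrA -expr2 v2; apply: (eq_of_sub (z := 4%:R * (2%:R + 3%:R * w + w ^+ 2))).
    by ring.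
  by rewrite h4 mul0r.
move=> v1; apply: r4; rewrite -D.
have v0 : 2%:R * (1 + w) = 0.
  apply: (eq_of_sub (z := ((1 + w) ^+ 2 - 1) - ((1 + w) ^+ 2 - (3%:R + 2%:R * w)))).
    by ring.
  by rewrite {2}v2 v1 !subrr.
apply: (eq_of_sub (z := 2%:R * ((1 + w) ^+ 2 - 1) - 2%:R * (1 + w) * (1 + w))).
  by ring.
by rewrite v1 v0 subrr mulr0 mul0r subrr.
Qed.

Lemma inverted_cyclic_units_dvd12 : (n %| 12)%N.
Proof.
have ord_dvd d : (d %| n)%N -> exists s si, [/\ s * si = 1, sg s = si, sg si = s
    & forall j, s ^+ j = 1 <-> (d %| j)%N].
  case/dvdnP=> q Dn; exists (t ^+ q), (ti ^+ q); split.
  - by rewrite -exprMn tti expr1n.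
  - by rewrite sgtX.
  - by rewrite rmorphXn sgti.
  move=> j; rewrite -exprM order_t Dn dvdn_pmul2l //.
  by move: n_gt0; rewrite Dn muln_gt0 => /andP[].
(* The idempotents 4 and 9 add up to 1 modulo 12. *)
have glue (x : S) : 4%:R * x = 4%:R -> 9%:R * x = 9%:R -> x = 1.
  move=> x4 x9; apply: (eq_of_sub (z := (4%:R * x - 4%:R) + (9%:R * x - 9%:R)
    - 12%:R * (x - 1))); first by ring.
  by rewrite x4 x9 h12; ring.
(* The prime 5 goes first: the five-term sum used for the odd part needs an order prime to 5. *)
have n5 : ~~ (5 %| n)%N.
  apply/negP => /ord_dvd[s [si [ssi sgs sgsi ord_s]]].
  have s5 : s ^+ 5 = 1 by apply/ord_s.
  have s1 : s = 1.
    apply: glue; last exact: odd_part2_order5 ssi sgs sgsi s5.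
    by apply: (fix_of_fixX s5 _ _ (odd_part3 ssi sgs sgsi s5 _)).
  by have /ord_s : s ^+ 1 = 1 by rewrite s1 expr1n.
pose b := (n`_2)%N; pose m := (n`_(2^'))%N.
have co5 : coprime 5 m.
  rewrite prime_coprime //; apply: contra n5 => h5.
  exact: dvdn_trans h5 (dvdn_part _ _).
have odd_m : odd m.
  rewrite -coprime2n; exact: (pnat_coprime (pnat_id _) (part_pnat _ _)).
have m3 : (m %| 3)%N.
  have [s [si [ssi sgs sgsi ord_s]]] := ord_dvd _ (dvdn_part 2^'%N n).
  have sm : s ^+ m = 1 by apply/ord_s.
  apply/ord_s; apply: glue; first exact: odd_part3 ssi sgs sgsi sm odd_m.
  exact: odd_part2_coprime5 ssi sgs sgsi sm odd_m co5.
have b4 : (b %| 4)%N.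
  rewrite /b p_part (_ : 4 = 2 ^ 2)%N // dvdn_Pexp2l // leqNgt.
  apply: contra not_8_dvd => l3.
  by rewrite (_ : 8 = 2 ^ 3)%N // pfactor_dvdn.
by rewrite -(partnC 2%N n_gt0) (_ : 12 = 4 * 3)%N // dvdn_mul.
Qed.

End InvertedCyclicUnits.

End InvertedUnits.

(** * The holomorph *)

Section Holomorph.

Local Open Scope group_scope.

Notation hol n := (sdprod_by [Aut (Zp_group n)]%gact).

Lemma cyclic_Zp n : cyclic (Zp n).
Proof.
rewrite /Zp; case: ifP => _; last exact: cyclic1.
by rewrite Zp_cycle cycle_cyclic.
Qed.

Lemma card_HolZ n : 0 < n -> #|HolZ n| = (n * totient n)%N.
Proof.
move=> n_gt0; rewrite -(sdprod_card (sdprod_sdpair [Aut (Zp_group n)]%gact)).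
rewrite (card_injm (injm_sdpair1 _)) // (card_injm (injm_sdpair2 _)) //.
by rewrite card_Aut_cyclic ?cyclic_Zp //= card_Zp.
Qed.

Lemma expg_Zp n (x : 'Z_n) : 1 < n -> x ^+ n = 1.
Proof.
move=> n_gt1; have : x \in Zp_group n by rewrite /= /Zp n_gt1 inE.
by move/expg_cardG; rewrite card_Zp // ltnW.
Qed.

(* [g] is the translation by 1 and [Y k] the multiplication by [k]. *)
Lemma HolZ_presentation n : 1 < n -> exists (g : hol n) (Y : nat -> hol n),
  [/\ #[g] = n,
      forall k, coprime k n -> g ^ Y k = g ^+ k,
      forall k l, coprime k n -> coprime l n -> Y k * Y l = Y (k * l)%N,
      forall k l, k = l %[mod n] -> Y k = Y l
    & forall h : hol n, exists2 k, coprime k n & exists j, h = Y k * g ^+ j].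
Proof.
move=> n_gt1; have n_gt0 : 0 < n by exact: ltnW.
have inZ (x : 'Z_n) : x \in Zp_group n by rewrite /= /Zp n_gt1 inE.
have expZmod (x : 'Z_n) k l : k = l %[mod n] -> x ^+ k = x ^+ l.
  by move=> kl; rewrite -(expg_mod k (expg_Zp x n_gt1)) kl expg_mod // expg_Zp.
have gen (x : 'Z_n) : exists j, x = Zp1 ^+ j.
  by have /cycleP[j ->] : x \in <[Zp1 : 'Z_n]>; [rewrite -Zp_cycle inE | exists j].
have ord1 : #[Zp1 : 'Z_n] = n by rewrite order_Zp1 Zp_cast.
have aut k : coprime k n -> exists a, (a \in Aut (Zp_group n)) &&
    [forall x : 'Z_n, a x == x ^+ k].
  move=> co; have inj : injective (fun x : 'Z_n => x ^+ k).
    apply: (can_inj (g := fun x => x ^+ (egcdn k n).1)) => x /=.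
    have k_gt0 : 0 < k.
      by case: (posnP k) co => // ->; rewrite /coprime gcd0n => /eqP E;
        move: n_gt1; rewrite E.
    rewrite -expgM; case: (egcdnP n k_gt0) => a b Dab _ /=.
    by rewrite mulnC Dab (eqP co) addn1 expgS mulnC expgM expg_Zp // expg1n mulg1.
  exists (perm inj); apply/andP; split; last by apply/forallP => x; rewrite permE.
  rewrite inE; apply/andP; split; first by apply/subsetP => x _; exact: inZ.
  apply/morphicP => x y _ _; rewrite !permE expgMn //.
  by apply: (centsP (Zp_abelian _)); rewrite inE.
(* The value of [pick] depends only on the predicate, so [A k] depends only on [k] modulo [n]; the
   default 1 is for [k] not prime to [n]. *)
pose A k := odflt 1 [pick a in Aut (Zp_group n) | [forall x : 'Z_n, a x == x ^+ k]].
have AP k : coprime k n -> A k \in Aut (Zp_group n) /\ forall x : 'Z_n, A k x = x ^+ k.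
  move=> /aut[a a_k]; rewrite /A; case: pickP => [b /andP[? /forallP b_k]|/(_ a)] /=.
    by split=> // x; apply/eqP.
  by rewrite a_k.
exists (sdpair1 _ Zp1), (fun k => sdpair2 _ (A k)); split.
- by rewrite (order_injm (injm_sdpair1 _)).
- move=> k /AP[Ak AkE]; rewrite -sdpair_act // -morphX //; congr (sdpair1 _ _); exact: AkE.
- move=> k l ck cl; have [[Ak AkE] [Al AlE]] := (AP _ ck, AP _ cl).
  have [Akl AklE] : _ := AP _ (etrans (coprimeMl _ _ _) (introT andP (conj ck cl))).
  rewrite -sdpair2_morphM //; congr (sdpair2 _ _); apply/permP => x.
  by rewrite permM AkE AlE AklE expgM.
- move=> k l kl; congr (sdpair2 _ (odflt _ _)); apply: eq_pick => a /=.
  by congr (_ && _); apply: eq_forallb => x; rewrite (expZmod x _ _ kl).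
move=> h; rewrite (sdpairE h); case: h => [[a x] /= /setXP[/= Aa _]].
have [k Dk] := gen (a Zp1); have [j Dj] := gen x.
have aX i : a (Zp1 ^+ i) = a Zp1 ^+ i.
  by rewrite -!(autmE Aa) morphX.
(* Automorphisms preserve order, while the [k]-th power of a generator has order n / gcd(n, k). *)
have ck : coprime k n.
  have : #[a Zp1] = n by rewrite -(autmE Aa) (order_injm (injm_autm Aa)).
  rewrite Dk orderXgcd ord1 => E; rewrite coprime_sym /coprime.
  have := divnK (dvdn_gcdl n k); rewrite E => nd.
  by rewrite -(eqn_pmul2l n_gt0) muln1 nd.
have [Ak AkE] := AP _ ck.
exists k => //; exists j; rewrite Dj morphX //; congr (sdpair2 _ _ * _).
apply/permP => y; have [i ->] := gen y; rewrite AkE aX Dk.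
by rewrite -!expgM mulnC.
Qed.

End Holomorph.

(** * Finite rings *)

Section DoubleCentralizer.

Local Open Scope ring_scope.

Variables (R : finPzRingType) (t : R).

Definition bicentral : {pred R} :=
  fun u => [forall z, (z * t == t * z) ==> (u * z == z * u)].

Lemma bicentralP u :
  reflect (forall z, z * t = t * z -> u * z = z * u) (u \in bicentral).
Proof.
apply: (iffP forallP) => [h z /eqP zt | h z]; last first.
  by apply/implyP => /eqP /h ->.
by have /implyP/(_ zt)/eqP := h z.
Qed.

Lemma bicentral_subring : subring_closed bicentral.
Proof.
split=> [|u v /bicentralP cu /bicentralP cv|u v /bicentralP cu /bicentralP cv];
  apply/bicentralP => z zt.
- by rewrite mul1r mulr1.
- by rewrite mulrBl mulrBr cu ?cv.
- by rewrite -mulrA cv // mulrA cu // mulrA.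
Qed.

Record bicentralizer := Bicentralizer { bival : R; _ : bival \in bicentral }.

HB.instance Definition _ := [isSub for bival].
HB.instance Definition _ := [Choice of bicentralizer by <:].
HB.instance Definition _ :=
  GRing.SubChoice_isSubPzRing.Build R bicentral bicentralizer bicentral_subring.

Lemma bicentral_comm (u : bicentralizer) : bival u * t = t * bival u.
Proof. by case: u => u /= /bicentralP; apply. Qed.

(** Elements of the double centralizer commute with [t], so they lie in the centralizer with which
    all of them commute. *)
Lemma bicentralizer_mulC : commutative (@GRing.mul bicentralizer).
Proof.
move=> u v; apply: val_inj; rewrite !rmorphM /=.
by case: u => u /= /bicentralP; apply; apply: bicentral_comm.
Qed.

HB.instance Definition _ :=
  GRing.PzRing_hasCommutativeMul.Build bicentralizer bicentralizer_mulC.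

Lemma mem_bicentral : t \in bicentral.
Proof. by apply/bicentralP => z ->. Qed.

Section Conjugation.

Variables (ti y yi : R).
Hypotheses (tti : t * ti = 1) (tit : ti * t = 1).
Hypotheses (yyi : y * yi = 1) (yiy : yi * y = 1) (yt : y * t = ti * y).

Lemma bicentral_inv : ti \in bicentral.
Proof.
apply/bicentralP => z zt.
by rewrite -[z in LHS]mulr1 -tti !mulrA -[ti * z * t]mulrA zt !mulrA tit mul1r.
Qed.

(** Conjugation by [y] exchanges [t] and its inverse, which have the same centralizer; so it
    preserves that centralizer and the double one. *)
Lemma bicentral_conj u : u \in bicentral -> y * u * yi \in bicentral.
Proof.
move=> /bicentralP cu; apply/bicentralP => z zt.
have /cu cz : (yi * z * y) * t = t * (yi * z * y).
  have zti : ti * z = z * ti by apply: (bicentralP _ bicentral_inv).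
  have tyi : t * yi = yi * ti.
    by rewrite -[t]mul1r -yiy -[yi * y * t]mulrA yt -!mulrA yyi mulr1.
  by rewrite -mulrA yt !mulrA tyi -[yi * z * ti]mulrA -zti !mulrA.
rewrite -[LHS]mulr1 -yyi.
have -> : y * u * yi * z * (y * yi) = y * (u * (yi * z * y)) * yi by rewrite !mulrA.
by rewrite cz !mulrA yyi mul1r.
Qed.

Definition bicentralizer_conj (u : bicentralizer) : bicentralizer :=
  Bicentralizer (bicentral_conj (valP u)).

Lemma bicentralizer_conj_zmod : zmod_morphism bicentralizer_conj.
Proof. by move=> u v; apply: val_inj; rewrite /= mulrBr mulrBl. Qed.

Lemma bicentralizer_conj_monoid : monoid_morphism bicentralizer_conj.
Proof.
split=> [|u v]; apply: val_inj => /=; first by rewrite mulr1 yyi.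
by rewrite !mulrA -[_ * yi * y]mulrA yiy mulr1.
Qed.

HB.instance Definition _ := GRing.isZmodMorphism.Build bicentralizer bicentralizer
  bicentralizer_conj bicentralizer_conj_zmod.
HB.instance Definition _ := GRing.isMonoidMorphism.Build bicentralizer bicentralizer
  bicentralizer_conj bicentralizer_conj_monoid.

Definition bicentralizer_conj_rmorphism :
  {rmorphism bicentralizer -> bicentralizer} := bicentralizer_conj.

End Conjugation.

End DoubleCentralizer.

Lemma units_inj (R : pzRingType) (u v : units R) : (val u).1 = (val v).1 -> u = v.
Proof.
move=> uv; apply: val_inj; have [_ u2] := unitsP u; have [v1 _] := unitsP v.
move: uv u2 v1; case: (val u) => a b; case: (val v) => c d /= -> ba cd.
by congr pair; rewrite -[RHS]mul1r -ba -mulrA cd mulr1.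
Qed.

Lemma units_valX (R : pzRingType) (u : units R) j :
  (val (u ^+ j)%g).1 = ((val u).1 ^+ j)%R.
Proof. by elim: j => // j IH; rewrite expgS exprS -IH. Qed.

Lemma natr_card0 (R : finPzRingType) : (#|R|%:R = 0 :> R)%R.
Proof.
pose Z : finZmodType := R.
have := expg_cardG (in_setT (1%R : Z)); rewrite FinRing.zmodXgE cardsT.
by [].
Qed.

Lemma HolZ_units_dvd12 n (R : finPzRingType) : 1 < n ->
  HolZ n \isog [set: units R] -> n %| 12.
Proof.
move=> n_gt1 /isogP[f injf imf].
have [g [Y [ord_g gY YM Ymod HolE]]] := HolZ_presentation n_gt1.
have gn : (g ^+ n = 1)%g by have := expg_order g; rewrite ord_g.
have co1 : coprime 1 n by rewrite coprime1n.
have Y1 : Y 1 = 1%g.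
  by apply: (@mulgI _ (Y 1)); rewrite YM // muln1 mulg1.
have con1 : coprime n.-1 n by rewrite -{2}(prednK (ltnW n_gt1)) coprimenS.
(* [n.-1] represents -1 modulo [n]. The inverse in [y0] accounts for the convention
   [x ^ y = y^-1 * x * y], as the ring automorphism is u -> y u y^-1. *)
set u0 := f g; set y0 := (f (Y n.-1))^-1%g.
have fM h k : f (h * k)%g = (f h * f k)%g by rewrite morphM ?inE.
have fX h k : f (h ^+ k)%g = (f h ^+ k)%g by rewrite morphX ?inE.
have yu : (y0 * u0 = u0^-1 * y0)%g.
  rewrite -[LHS](mulgK (f (Y n.-1))); congr (_ * _)%g.
  rewrite -mulgA -conjgE -morphJ ?inE // gY // -morphV ?inE //; congr (f _).
  by apply/eqP; rewrite eq_sym eq_invg_mul -expgS prednK ?gn // ltnW.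
have [t1 t2] := unitsP u0; have [y1 y2] := unitsP y0.
have yt : ((val y0).1 * (val u0).1 = (val u0).2 * (val y0).1)%R.
  by have := congr1 (fun u => (val u).1) yu.
pose sg := bicentralizer_conj_rmorphism t1 t2 y1 y2 yt.
pose t := Bicentralizer (mem_bicentral (val u0).1).
pose ti := Bicentralizer (bicentral_inv t1 t2).
have ord_t j : (t ^+ j = 1)%R <-> n %| j.
  rewrite -ord_g order_dvdn; split=> [tj|/eqP gj].
    have /(injmP injf) -> // : f (g ^+ j)%g = f 1%g; rewrite ?inE //.
    rewrite fX morph1; apply: units_inj; rewrite units_valX.
    by have := congr1 val tj; rewrite rmorphXn rmorph1 /=.
  apply: val_inj; rewrite rmorphXn /= -units_valX -fX gj morph1 //.
apply: (@inverted_cyclic_units_dvd12 _ sg t ti n #|R|) => //.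
- exact: ltnW.
- by apply/card_gt0P; exists 0%R.
- by apply: val_inj; rewrite rmorph_nat natr_card0.
- exact: val_inj.
- by apply: val_inj; rewrite /= yt -mulrA y1 mulr1.
move=> u v uv.
have uv1 : (val u * val v = 1)%R by rewrite -rmorphM uv rmorph1.
have vu1 : (val v * val u = 1)%R by rewrite -rmorphM mulrC uv rmorph1.
have wP : ((val u, val v).1 * (val u, val v).2 == 1)%R &&
          ((val u, val v).2 * (val u, val v).1 == 1)%R.
  by rewrite /= uv1 vu1 !eqxx.
pose w : units R := Units wP.
have : w \in (f @* HolZ n)%g by rewrite imf inE.
case/morphimP => h _ _ Dw.
have [k ck [j Dh]] := HolE h.
(* [h] commutes with [g], while [Y k * g ^+ j] conjugates [g] to [g ^+ k]; so [k] is 1 modulo [n]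
   and [h] is a power of [g]. *)
have hg : (g ^ h = g)%g.
  apply/conjg_fixP/commgP; apply: (injmP injf); rewrite ?inE // !fM -Dw.
  by apply: units_inj => /=; rewrite -bicentral_comm.
exists j; apply: val_inj; rewrite rmorphXn /= -units_valX -fX.
suff -> : (g ^+ j)%g = h by rewrite -Dw.
have gk : (g ^+ k = g)%g.
  have gg : (g ^ (g ^+ j) = g)%g by rewrite conjgE -expgS expgSr mulKg.
  by rewrite -[RHS]hg Dh conjgM gY // conjXg gg.
rewrite Dh (Ymod k 1) ?Y1 ?mul1g //; apply/eqP.
have : (g ^+ k == g ^+ 1)%g by rewrite gk expg1.
by rewrite eq_expg_mod_order ord_g.
Qed.

(** * Products of dihedral groups *)

Section Dihedral.

Local Open Scope group_scope.

Lemma dihedral_generators k : 1 < k -> exists x y : 'D_k.*2,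
  [/\ [set: 'D_k.*2] = <[x]> <*> <[y]>, x ^+ k = 1, y ^+ 2 = 1 & x ^ y = x^-1].
Proof.
move=> k_gt1; case/existsP: (isoGrp_hom (Grp_dihedral k_gt1)) => -[x y] /=.
by case/eqP => defD xk y2 xy; exists x, y.
Qed.

Lemma mem_inverted_join (gT : finGroupType) (x y z : gT) :
    y ^+ 2 = 1 -> x ^ y = x^-1 -> z \in <[x]> <*> <[y]> ->
  exists i, z = x ^+ i \/ z = x ^+ i * y.
Proof.
move=> y2 xy; rewrite norm_joinEr; last first.
  by rewrite cycle_subG; apply/normP; rewrite -cycleJ xy cycleV.
case/mulsgP=> _ _ /cycleP[i ->] /cycleP[j ->] ->; exists i.
rewrite -(odd_double_half j) expgD -mul2n expgM y2 expg1n mulg1.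
by case: odd; [right | left; rewrite mulg1].
Qed.

Lemma dihedral_rotations k : 0 < k -> exists C : {set dihedral k},
  [/\ {in C &, forall x y, x ^ y = x}, forall x, x \notin C -> x ^+ 2 = 1
    & forall x y, x \in C -> y \notin C -> x ^ y = x^-1].
Proof.
rewrite /dihedral; case: (eqVneq k 1%N) => [_ _|k1 k_gt0].
  (* The group of order 2 is abelian, so [C] can be all of it and the last two clauses are
     vacuous. *)
  exists setT; split=> [x y _ _|x|x y _]; rewrite ?inE //.
  by apply/conjg_fixP/commgP/(centsP (Zp_abelian _)); rewrite inE.
have k_gt1 : 1 < k by rewrite ltn_neqAle eq_sym k1.
have [x [y [defD xk y2 xy]]] := dihedral_generators k_gt1.
have elt z : exists i, z = x ^+ i \/ z = x ^+ i * y.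
  by apply: mem_inverted_join => //; rewrite -defD inE.
have inv i : (x ^+ i) ^ y = x ^- i by rewrite conjXg xy expgVn.
have yV : y^-1 = y by apply/eqP; rewrite eq_invg_mul -expg2 y2.
have nC z : z \notin <[x]> -> exists i, z = x ^+ i * y.
  by case: (elt z) => i [-> | -> _]; [rewrite mem_cycle | exists i].
exists <[x]>; split=> [_ _ /cycleP[i ->] /cycleP[j ->]|z /nC[i ->]|].
- by apply/conjg_fixP/commgP/commuteX2.
- by rewrite expgS expg1 -mulgA -{1}yV -conjgE inv mulgV.
move=> _ z /cycleP[i ->] /nC[j ->]; rewrite conjgM -inv; congr (_ ^ _).
by apply/conjg_fixP/commgP/commuteX2.
Qed.

(* A normal abelian subgroup of rotations, inverted by the involutions outside it,
   forces these two implications, and they pass to direct products. *)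
Lemma dihedral_conjX k (x y : dihedral k) a : 0 < k ->
  x ^ y = x ^+ a -> x ^ (y ^+ 2) = x.
Proof.
move=> /dihedral_rotations[C [cC nC2 inv]] xy.
have [Cy|/nC2 ->] := boolP (y \in C); last by rewrite conjg1.
have [Cx|/nC2 x2] := boolP (x \in C); first by rewrite expgS expg1 conjgM !cC.
suff xyx : x ^ y = x by rewrite expgS expg1 conjgM !xyx.
(* As x^2 = 1, x^a is [x] or 1 according to the parity of [a], and in the second case [x] itself is
   trivial. *)
move: xy; rewrite -(odd_double_half a) expgD -mul2n expgM x2 expg1n mulg1.
by case: odd => //; rewrite expg0 => /eqP; rewrite conjg_eq1 => /eqP ->; rewrite conj1g.
Qed.

Lemma dihedral_conjX5 k (x y : dihedral k) : 0 < k ->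
  x ^+ 8 = 1 -> x ^ y = x ^+ 5 -> x ^+ 4 = 1.
Proof.
move=> /dihedral_rotations[C [cC nC2 inv]] x8 xy.
have [Cx|/nC2 x2] := boolP (x \in C); last by rewrite (expgM _ 2 2) x2 expg1n.
apply: (mulgI x); rewrite -expgS -xy mulg1.
have [Cy|nCy] := boolP (y \in C); first by rewrite cC.
have x6 : x ^+ 6 = 1 by rewrite expgS -xy inv // mulgV.
have x2 : x ^+ 2 = 1 by rewrite -x8 (expgD x 6 2) x6 mul1g.
by rewrite inv //; apply/eqP; rewrite eq_invg_mul -expg2 x2.
Qed.

Lemma HolZ_dihedral_dvd12 n r (k : 'I_r -> nat) : 1 < n ->
    (forall i, 0 < k i) ->
    HolZ n \isog [set: {dffun forall i : 'I_r, dihedral (k i)}] ->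
  n %| 12.
Proof.
move=> n_gt1 k_gt0 /isogP[f injf _].
have [g [Y [ord_g gY _ _ _]]] := HolZ_presentation n_gt1.
have gn : g ^+ n = 1 by have := expg_order g; rewrite ord_g.
have fJ h l i : f (h ^ l) i = f h i ^ f l i by rewrite morphJ ?inE // !ffunE.
have fX h l i : f (h ^+ l) i = f h i ^+ l
  by rewrite morphX ?inE //; elim: l => [|l IH]; rewrite ?expgS ffunE ?IH.
have f1 i : f 1 i = 1 by rewrite morph1 ffunE.
have finj h l : (forall i, f h i = f l i) -> h = l.
  by move=> hl; apply: (injmP injf); rewrite ?inE //; apply/ffunP.
have n24 : n %| 24.
  apply: dvdn24_of_sqr_mod (ltnW n_gt1) _ => a ca.
  have : g ^ (Y a ^+ 2) = g.
    apply: finj => i; rewrite fJ fX; apply: dihedral_conjX (k_gt0 i) _.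
    by rewrite -fJ gY // fX.
  rewrite expg2 conjgM gY // conjXg gY // -expgM -[RHS]expg1 => /eqP.
  by rewrite eq_expg_mod_order ord_g => /eqP.
have n8 : ~~ (8 %| n).
  apply/negP => /dvdnP[q Dn].
  have c5 : coprime 5 n by apply: coprime_dvdr n24 _.
  have : (g ^+ q) ^+ 4 = 1.
    apply: finj => i; rewrite f1 fX; apply: (@dihedral_conjX5 _ _ (f (Y 5) i)) => //.
      by rewrite -fX -expgM -Dn gn f1.
    by rewrite -fJ conjXg gY // -!fX expgAC.
  rewrite -expgM => /eqP; rewrite -order_dvdn ord_g Dn => /dvdn_leq.
  lia.
exact: dvdn12_of_dvdn24.
Qed.

End Dihedral.

(** * Polynomial rings *)

Section PolynomialUnits.

Local Open Scope ring_scope.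

Lemma natr_Zp_eq0 n a : (1 < n)%N -> (a%:R == 0 :> 'Z_n) = (n %| a)%N.
Proof. by move=> n_gt1; rewrite -val_eqE /= val_Zp_nat. Qed.

Lemma intr_Zp_eq0 n (z : int) : (1 < n)%N -> (z%:~R == 0 :> 'Z_n) = (n %| `|z|)%N.
Proof.
move=> n_gt1; case: z => a; first by rewrite -pmulrn natr_Zp_eq0.
by rewrite NegzE mulrNz oppr_eq0 -pmulrn natr_Zp_eq0 // abszN.
Qed.

(** Allows a polynomial over ['Z_n] to be lifted to the integers and read modulo the prime divisors
    of [n]. *)
Lemma map_intr_eq n (P Q : {poly int}) : (1 < n)%N ->
  map_poly intr P = map_poly intr Q :> {poly 'Z_n} <->
  forall i, (n %| absz (P`_i - Q`_i)%R)%N.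
Proof.
move=> n_gt1; rewrite -polyP; split=> eqPQ i.
  by rewrite -intr_Zp_eq0 // rmorphB subr_eq0 -!coef_map eqPQ.
by apply/eqP; rewrite !coef_map -subr_eq0 -rmorphB intr_Zp_eq0 //.
Qed.

Lemma poly_unit_const (F : fieldType) (p q : {poly F}) : p * q = 1 ->
  exists2 c, p = c%:P & c != 0.
Proof.
move=> pq; have : p \is a GRing.unit by apply/unitrPr; exists q.
rewrite poly_unitE => /andP[/eqP sp].
by rewrite (size1_polyC (eq_leq sp)) coefC eqxx unitfE; exists p`_0.
Qed.

(** Modulo 3 a unit is a nonzero constant, of square 1. Modulo 2 it is 1, so a lift [P] has [P - 1]
    even and P^2 - 1 = (P - 1)(P - 1 + 2) is divisible by 4. *)
Lemma polyZ_units_sqr n (p q : {poly 'Z_n}) : (1 < n)%N -> (n %| 12)%N ->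
  p * q = 1 -> p * p = 1.
Proof.
move=> n_gt1 n12 pq.
pose lift (r : {poly 'Z_n}) : {poly int} := map_poly (fun z : 'Z_n => (z : nat)%:Z) r.
have liftK r : map_poly intr (lift r) = r.
  by apply/polyP => i; rewrite coef_map coef_map_id0 //= -pmulrn natr_Zp.
set P := lift p; set Q := lift q.
have modPQ d : (1 < d)%N -> (d %| n)%N ->
    map_poly intr P * map_poly intr Q = 1 :> {poly 'Z_d}.
  move=> d_gt1 dn; rewrite -rmorphM -(rmorph1 (map_poly intr)).
  apply/map_intr_eq => // i; apply: dvdn_trans dn _; move: i.
  by apply/map_intr_eq; rewrite // rmorphM rmorph1 /= !liftK.
rewrite -[p]liftK -rmorphM -(rmorph1 (map_poly intr)); apply/map_intr_eq => // i.
set c := absz _.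
have c3 : (3 %| n)%N -> (3 %| c)%N.
  move=> n3; move: i @c; apply/map_intr_eq; rewrite // rmorphM rmorph1 /=.
  have [a -> a0] := poly_unit_const (F := 'F_3) (modPQ 3%N isT n3).
  by rewrite -polyCM; congr (_%:P); apply: val_inj; case: a a0 => [[|[|[|]]]].
have c4 : (2 %| n)%N -> (4 %| c)%N.
  move=> n2; have [a Pa a0] := poly_unit_const (F := 'F_2) (modPQ 2%N isT n2).
  have P2 : forall j, (2 %| absz (P`_j - (1 : {poly int})`_j)%R)%N.
    apply/map_intr_eq => //; rewrite rmorph1 Pa; congr (_%:P).
    by apply: val_inj; case: a a0 {Pa} => [[|[|]]].
  rewrite /c -/P -coefB (_ : P * P - 1 = (P - 1) * (P - 1 + 2%:R)); last by ring.
  rewrite coefM -[4%N]/(absz 4) -(dvdzE 4); apply: rpred_sum => j _.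
  rewrite dvdzE abszM; apply: (@dvdn_mul 2 2); first by rewrite coefB P2.
  rewrite -[2%N]/(absz 2) -(dvdzE 2) coefD; apply: rpredD.
    by rewrite dvdzE coefB P2.
  by rewrite coefMn; apply/dvdzP; exists ((1 : {poly int})`_(i - j)); rewrite mulr_natr.
(* According to which of 2 and 3 divide it, [n] divides 12, 4, 3 or 1, the last being excluded. *)
have [n2|n2] := boolP (2 %| n)%N; have [n3|n3] := boolP (3 %| n)%N.
- by apply: dvdn_trans n12 _; rewrite (@Gauss_dvd 4 3) // c4 // c3.
- apply: dvdn_trans (c4 n2); rewrite -(@Gauss_dvdl _ 4 3) //.
  by rewrite coprime_sym prime_coprime.
- apply: dvdn_trans (c3 n3); rewrite -(@Gauss_dvdl _ 3 4) //.
  by apply: (@coprimeXr 2 n 2); rewrite coprime_sym prime_coprime.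
have co : coprime n 12.
  rewrite (@coprimeMr n 4 3); apply/andP; split.
    by apply: (@coprimeXr 2 n 2); rewrite coprime_sym prime_coprime.
  by rewrite coprime_sym prime_coprime.
by move: n12 n_gt1; rewrite -[12%N]muln1 Gauss_dvdr // dvdn1 => /eqP->.
Qed.

Lemma polyZ_units_dvd12 n : (1 < n)%N ->
  (forall p q : {poly 'Z_n}, p * q = 1 -> p * p = 1) -> (n %| 12)%N.
Proof.
move=> n_gt1 sq1.
have n24 : (n %| 24)%N.
  apply: dvdn24_of_sqr_mod (ltnW n_gt1) _ => a ca.
  have ua : (a%:R : 'Z_n) \is a GRing.unit by rewrite unitZpE // coprime_sym.
  have /sq1 : (a%:R%:P : {poly 'Z_n}) * (a%:R^-1)%:P = 1.
    by rewrite -polyCM divrr.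
  rewrite -polyCM => /polyC_inj; rewrite -natrM => a2.
  have := congr1 (fun z : 'Z_n => z : nat) a2; rewrite val_Zp_nat // -mulnn => ->.
  by rewrite modn_small // modn_small.
have h24 : 24%:R = 0 :> {poly 'Z_n}.
  by rewrite -polyC_natr; apply/eqP; rewrite polyC_eq0 natr_Zp_eq0.
(* The inverse is a truncated geometric series, with error 216 x^3 = 24 * 9 x^3. *)
have /sq1 : (1 + 6%:R * 'X) * (1 - 6%:R * 'X + 36%:R * 'X ^+ 2) = 1 :> {poly 'Z_n}.
  apply: (eq_of_sub (z := 24%:R * (9%:R * 'X ^+ 3))); first by ring.
  by rewrite h24 mul0r.
move/(congr1 (fun p : {poly 'Z_n} => p`_1)).
have -> : (1 + 6%:R * 'X) * (1 + 6%:R * 'X) =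
  1 + 12%:R *: 'X + 36%:R *: 'X ^+ 2 :> {poly 'Z_n}.
  rewrite -!mul_polyC !polyC_natr; ring.
rewrite !coefD !coefZ coefX coefXn coef1 /= mulr1 mulr0 addr0 add0r => /eqP.
by rewrite natr_Zp_eq0.
Qed.

End PolynomialUnits.

(** * Realizations *)

Section DihedralRecognition.

Local Open Scope group_scope.

Lemma homg_dihedral (gT : finGroupType) (x y : gT) k : 1 < k ->
  x ^+ k = 1 -> y ^+ 2 = 1 -> x ^ y = x^-1 -> <[x]> <*> <[y]> \homg [set: 'D_k.*2].
Proof.
move=> k_gt1 xk y2 xy; rewrite (Grp_dihedral k_gt1).
by apply/existsP; exists (x, y); rewrite /= xk y2 xy !eqxx.
Qed.

(** The subgroup generated by [x] and [y] has order a proper multiple of [k], so it is all of [G];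
    the dihedral presentation then maps onto [G], and the orders agree. *)
Lemma isog_dihedral (gT : finGroupType) (G : {group gT}) x y k : 1 < k ->
    x \in G -> y \in G -> #|G| = k.*2 -> #[x] = k -> y \notin <[x]> ->
    y ^+ 2 = 1 -> x ^ y = x^-1 ->
  G \isog [set: 'D_k.*2].
Proof.
move=> k_gt1 Gx Gy cG ox nxy y2 xy.
have sHG : <[x]> <*> <[y]> \subset G by rewrite join_subG !cycle_subG Gx.
have xk : x ^+ k = 1 by rewrite -ox expg_order.
have DG : G = (<[x]> <*> <[y]>)%G.
  apply/eqP; rewrite eq_sym -val_eqE eqEcard sHG cG /=.
  have /dvdnP[c Dc] : k %| #|<[x]> <*> <[y]>|.
    by rewrite -ox orderE cardSg ?joing_subl.
  have : #|<[x]>| < #|<[x]> <*> <[y]>|.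
    by apply/proper_card; rewrite /proper joing_subl join_subG !cycle_subG negb_and nxy orbT.
  rewrite -orderE ox Dc -mul2n leq_pmul2r ?(ltnW k_gt1) //.
  by case: c {Dc} => [|[|c]] //; rewrite ?mul1n ?ltnn.
rewrite isogEcard card_dihedral // cG leqnn andbT DG.
exact: homg_dihedral.
Qed.

Lemma isog_setX1 (gT rT : finGroupType) (G : {group gT}) : G \isog setX G (1 : {set rT}).
Proof. by rewrite -morphim_pairg1 sub_isog ?injm_pairg1 ?subsetT. Qed.

Lemma isog_set1X (gT rT : finGroupType) (G : {group gT}) : G \isog setX (1 : {set rT}) G.
Proof. by rewrite -morphim_pair1g sub_isog ?injm_pair1g ?subsetT. Qed.

Lemma isog_setX (gT1 gT2 rT1 rT2 : finGroupType) (G1 : {group gT1}) (G2 : {group gT2})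
    (H1 : {group rT1}) (H2 : {group rT2}) :
  G1 \isog H1 -> G2 \isog H2 -> setX G1 G2 \isog setX H1 H2.
Proof.
move=> iso1 iso2; apply: (isog_dprod (setX_dprod _ _) (setX_dprod _ _)).
  apply: isog_trans (isog_setX1 _ _); rewrite isog_sym.
  by apply: isog_trans (isog_setX1 _ _); rewrite isog_sym.
apply: isog_trans (isog_set1X _ _); rewrite isog_sym.
by apply: isog_trans (isog_set1X _ _); rewrite isog_sym.
Qed.

(** The two generated subgroups [A] and [B] commute and are quotients of the dihedral groups, so |A|
    |B| is at most |G|, while A B contains [G]. Equality throughout makes the product direct and
    both quotient maps isomorphisms. *)
Lemma isog_dihedral_setX (gT : finGroupType) (G : {group gT}) x1 y1 x2 y2 k l :
    1 < k -> 1 < l -> #|G| = (k.*2 * l.*2)%N ->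
    G \subset (<[x1]> <*> <[y1]>) <*> (<[x2]> <*> <[y2]>) ->
    x1 ^+ k = 1 -> y1 ^+ 2 = 1 -> x1 ^ y1 = x1^-1 ->
    x2 ^+ l = 1 -> y2 ^+ 2 = 1 -> x2 ^ y2 = x2^-1 ->
    x1 ^ x2 = x1 -> x1 ^ y2 = x1 -> y1 ^ x2 = y1 -> y1 ^ y2 = y1 ->
  G \isog setX [set: 'D_k.*2] [set: 'D_l.*2].
Proof.
move=> k_gt1 l_gt1 cG sG x1k y12 xy1 x2l y22 xy2 cxx cxy cyx cyy.
set A := (<[x1]> <*> <[y1]>)%G; set B := (<[x2]> <*> <[y2]>)%G.
have k2_gt0 : 0 < k.*2 by rewrite double_gt0 ltnW.
have l2_gt0 : 0 < l.*2 by rewrite double_gt0 ltnW.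
have cAB : B \subset 'C(A).
  have comm (x y : gT) : x ^ y = x -> y \in 'C[x].
    by move=> h; apply/cent1P/commute_sym/commgP/conjg_fixP.
  by rewrite join_subG !cycle_subG /= !centY !inE !cent_cycle !comm.
have hA : A \homg [set: 'D_k.*2] by exact: homg_dihedral.
have hB : B \homg [set: 'D_l.*2] by exact: homg_dihedral.
have lA : #|A| <= k.*2 by rewrite -(card_dihedral k_gt1) leq_homg.
have lB : #|B| <= l.*2 by rewrite -(card_dihedral l_gt1) leq_homg.
have sGAB : G \subset A * B by rewrite -cent_joinEr.
have lG : k.*2 * l.*2 <= #|A * B|%g by rewrite -cG subset_leq_card.
have cM := mul_cardG A B; have cI := cardG_gt0 (A :&: B).
have lM : #|A| * #|B| <= k.*2 * l.*2 by exact: leq_mul.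
have eM : (#|A| * #|B| = k.*2 * l.*2)%N.
  apply/eqP; rewrite eqn_leq lM cM (leq_trans lG) // -{1}[#|_|]muln1.
  by rewrite leq_mul2l cI orbT.
have eAB : #|(A * B)%g| = (k.*2 * l.*2)%N.
  apply/eqP; rewrite eqn_leq lG -eM cM -{1}[#|_|]muln1.
  by rewrite leq_mul2l cI orbT.
have tiAB : A :&: B = 1.
  apply: card_le1_trivg.
  move/eqP: cM; rewrite eM eAB -{1}[(_ * _)%N]muln1 eqn_pmul2l; last first.
    by rewrite muln_gt0 k2_gt0.
  by move=> /eqP <-.
have eA : #|A| = k.*2.
  apply/eqP; rewrite eqn_leq lA /=; rewrite -(@leq_pmul2r l.*2) //.
  by rewrite -eM leq_mul2l lB orbT.
have eB : #|B| = l.*2.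
  apply/eqP; rewrite eqn_leq lB /=; rewrite -(@leq_pmul2l k.*2) //.
  by rewrite -eM leq_mul2r lA orbT.
have DG : A \x B = G.
  by rewrite dprodE //; apply/eqP; rewrite eq_sym eqEcard sGAB cG eAB /=.
apply: (isog_dprod DG (setX_dprod _ _)).
  apply: isog_trans (_ : A \isog [set: 'D_k.*2]) (isog_setX1 _ _).
  by rewrite isogEcard hA card_dihedral // eA /=.
apply: isog_trans (_ : B \isog [set: 'D_l.*2]) (isog_set1X _ _).
by rewrite isogEcard hB card_dihedral // eB /=.
Qed.

Lemma isog_setT (gT rT : finGroupType) (f : gT -> rT) :
    {morph f : x y / x * y} -> injective f -> (forall y, exists x, f x = y) ->
  [set: gT] \isog [set: rT].
Proof.
move=> fM f_inj f_surj; apply/isogP; exists (Morphism (in2W fM)) => /=.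
  by apply/injmP => x y _ _; apply: f_inj.
apply/setP => y; have [x <-] := f_surj y; rewrite inE.
by apply/morphimP; exists x; rewrite ?inE.
Qed.

Lemma dffun1_isog (T : 'I_1 -> finGroupType) :
  [set: T ord0] \isog [set: {dffun forall i : 'I_1, T i}].
Proof.
apply: (@isog_setT _ _ (@dfung1 _ T ord0)).
- exact: dfung1_morphM.
- by move=> x y xy; rewrite -[x]dfung1_id xy dfung1_id.
move=> h; exists (h ord0); apply/ffunP => i.
by rewrite (ord1 i) dfung1_id.
Qed.

Lemma dffun2_isog (T : 'I_2 -> finGroupType) :
  setX [set: T ord0] [set: T ord_max] \isog [set: {dffun forall i : 'I_2, T i}].
Proof.
have -> : setX [set: T ord0] [set: T ord_max] = [set: T ord0 * T ord_max].
  by apply/setP => u; rewrite !inE.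
pose f (h : {dffun forall i : 'I_2, T i}) : T ord0 * T ord_max := (h ord0, h ord_max).
rewrite isog_sym; apply: (@isog_setT _ (T ord0 * T ord_max)%type f).
- by move=> h l; rewrite /f !ffunE.
- move=> h l [h0 h1]; apply/ffunP => i.
  by case: (unliftP ord0 i) => [j|] ->;
    rewrite ?ord1 // (_ : lift _ _ = ord_max) //; apply: val_inj.
move=> [a b]; exists (@dfung1 _ T ord0 a * @dfung1 _ T ord_max b).
by rewrite /f !dffunM !dfung1_id !dfung1_dflt // mulg1 mul1g.
Qed.

Lemma dihedral_isog k : 1 < k -> [set: dihedral k] \isog [set: 'D_k.*2].
Proof.
by rewrite /dihedral; case: (eqVneq k 1%N) => [->|_ _] //; apply: isog_refl.
Qed.

End DihedralRecognition.

(** * Holomorphs that are dihedral or products of dihedral groups *)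

Section RealizingRings.

Local Open Scope group_scope.

Lemma HolZ_isog_dihedral n : 2 < n -> totient n = 2 ->
  HolZ n \isog [set: 'D_n.*2].
Proof.
move=> n_gt2 tn; have n_gt1 : 1 < n by exact: ltnW.
have [g [Y [ord_g gY YM Ymod _]]] := HolZ_presentation n_gt1.
have gn : g ^+ n = 1 by have := expg_order g; rewrite ord_g.
have co1 : coprime 1 n by rewrite coprime1n.
have Y1 : Y 1%N = 1 by apply: (@mulgI _ (Y 1%N)); rewrite YM // muln1 mulg1.
have con1 : coprime n.-1 n by rewrite -{2}(prednK (ltnW n_gt1)) coprimenS.
have gV : g ^+ n.-1 = g^-1.
  by apply/eqP; rewrite eq_sym eq_invg_mul -expgS prednK ?gn // ltnW.
apply: (@isog_dihedral _ _ g (Y n.-1));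
  rewrite ?inE ?card_HolZ ?tn ?muln2 ?gY ?(ltnW n_gt1) //.
  (* A power of [g] would fix [g] instead of inverting it, giving g^2 = 1 although n > 2. *)
  apply/negP => /cycleP[i Yi]; have := gY _ con1.
  rewrite Yi gV conjgE -expgS expgSr mulKg => gg.
  have : g ^+ 2 = 1 by rewrite expg2 -{1}[g]invgK -gg mulVg.
  by move=> /eqP; rewrite -order_dvdn ord_g => /dvdn_leq; lia.
rewrite expg2 YM // -Y1; apply: Ymod; apply/eqP.
rewrite -(eqn_modDr n.-1.*2).
have -> : (n.-1 * n.-1 + n.-1.*2 = 1 + n * (n - 2) + n.-1.*2)%N.
  case: (n) n_gt2 => [|[|m]] //= _; nia.
by rewrite eqn_modDr mulnC addnC modnMDl.
Qed.

(** This follows the splitting of Z_12 into Z_4, generated by [g ^+ 3], and Z_3, generated by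
    [g ^+ 4]: 7 is -1 modulo 4 and 1 modulo 3, while 5 is 1 modulo 4 and -1 modulo 3. *)
Lemma HolZ12_isog : HolZ 12 \isog setX [set: 'D_8] [set: 'D_6].
Proof.
have [g [Y [ord_g gY YM Ymod HolE]]] := @HolZ_presentation 12 isT.
have gmod i j : (i == j %[mod 12])%N -> g ^+ i = g ^+ j.
  by move=> ij; apply/eqP; rewrite eq_expg_mod_order ord_g.
have co1 : coprime 1 12 by [].
have Y1 : Y 1%N = 1 by apply: (@mulgI _ (Y 1%N)); rewrite YM // muln1 mulg1.
have Ysq k : coprime k 12 -> k * k = 1 %[mod 12] -> Y k ^+ 2 = 1.
  by move=> ck k2; rewrite expg2 YM // -Y1; apply: Ymod.
have gXY i k : coprime k 12 -> (g ^+ i) ^ Y k = g ^+ (k * i).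
  by move=> ck; rewrite conjXg gY // expgM.
have gV i j : (i + j == 0 %[mod 12])%N -> g ^+ i = (g ^+ j)^-1.
  move=> ij; apply/eqP; rewrite eq_sym eq_invg_mul -expgD addnC.
  by rewrite (gmod _ 0).
apply: (@isog_dihedral_setX _ _ (g ^+ 3) (Y 7) (g ^+ 4) (Y 5) 4 3) => //.
- by rewrite card_HolZ.
- apply/subsetP => h _; have [k ck [j ->]] := HolE h.
  set J := _ <*> _.
  have Jg3 : g ^+ 3 \in J by rewrite mem_gen // inE mem_gen // inE cycle_id.
  have Jg4 : g ^+ 4 \in J by rewrite mem_gen // inE orbC mem_gen // inE cycle_id.
  have J7 : Y 7 \in J by rewrite mem_gen // inE mem_gen // inE cycle_id orbT.
  have J5 : Y 5 \in J by rewrite mem_gen // inE orbC mem_gen // inE cycle_id orbT.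
  have Jg : g \in J.
    have -> : g = (g ^+ 3) ^+ 3 * g ^+ 4 by rewrite -expgM -expgD -[LHS]expg1; apply: gmod.
    by rewrite groupM // groupX.
  rewrite groupM ?groupX //.
  have YJ l : k %% 12 = l -> Y l \in J -> Y k \in J.
    by move=> kl; rewrite (Ymod k l) // -kl modn_mod.
  have : coprime (k %% 12) 12 by rewrite coprime_modl.
  (* The residues prime to 12 are 1, 5, 7 and 11, and 11 is 5 * 7 modulo 12. *)
  case Dk: (k %% 12) (ltn_pmod k (isT : 0 < 12)) => [|[|[|[|[|[|[|[|[|[|[|[|?]]]]]]]]]]]] // _ _;
    apply: (YJ _ Dk) => //.
    by rewrite Y1 group1.
  by rewrite (Ymod 11 (5 * 7)%N) // -YM // groupM.
- by rewrite -expgM (gmod _ 0).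
- exact: Ysq.
- by rewrite gXY //; apply: gV.
- by rewrite -expgM (gmod _ 0).
- exact: Ysq.
- by rewrite gXY //; apply: gV.
- by apply/conjg_fixP/commgP/commuteX2.
- by rewrite gXY //; apply: gmod.
- apply/conjg_fixP/commgP/commute_sym/commgP/conjg_fixP.
  by rewrite gXY //; apply: gmod.
by apply/conjg_fixP/commgP; rewrite /commute !YM.
Qed.

End RealizingRings.

HB.instance Definition _ (R1 R2 : finPzRingType) := GRing.PzRing.on (R1 * R2)%type.

(** * Unit groups of products and of small finite rings *)

Section RingUnits.

Local Open Scope ring_scope.

Lemma units_prod_isog (R1 R2 : finPzRingType) :
  [set: units (R1 * R2)%type] \isog setX [set: units R1] [set: units R2].
Proof.
have -> : setX [set: units R1] [set: units R2] = [set: units R1 * units R2].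
  by apply/setP => u; rewrite !inE.
have P1 (u : units (R1 * R2)%type) (w := ((val u).1.1, (val u).2.1)) :
    (w.1 * w.2 == 1) && (w.2 * w.1 == 1).
  by have [/(congr1 fst) /= u1 /(congr1 fst) /= u2] := unitsP u; rewrite /= u1 u2 eqxx.
have P2 (u : units (R1 * R2)%type) (w := ((val u).1.2, (val u).2.2)) :
    (w.1 * w.2 == 1) && (w.2 * w.1 == 1).
  by have [/(congr1 snd) /= u1 /(congr1 snd) /= u2] := unitsP u; rewrite /= u1 u2 eqxx.
pose f u : units R1 * units R2 := (Units (P1 u), Units (P2 u)).
apply: (@isog_setT _ (units R1 * units R2)%type f).
- by move=> u v; congr pair; apply: units_inj.
- move=> u v [uv1 _ uv2 _]; apply: units_inj.
  by rewrite [LHS]surjective_pairing uv1 uv2 -surjective_pairing.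
move=> [u v]; have [u1 u2] := unitsP u; have [v1 v2] := unitsP v.
have P (w : (R1 * R2) * (R1 * R2) := (((val u).1, (val v).1), ((val u).2, (val v).2))) :
    (w.1 * w.2 == 1) && (w.2 * w.1 == 1).
  by apply/andP; split; apply/eqP; [exact: (congr2 pair u1 v1) | exact: (congr2 pair u2 v2)].
by exists (Units P); congr pair; apply: units_inj.
Qed.

Lemma units_isog (R : finUnitRingType) : [set: {unit R}] \isog [set: units R].
Proof.
have P (u : {unit R}) (w := (val u, (val u)^-1)) : (w.1 * w.2 == 1) && (w.2 * w.1 == 1).
  by rewrite /= divrr ?mulVr ?eqxx // (valP u).
apply: (@isog_setT _ _ (fun u => Units (P u))).
- by move=> u v; apply: units_inj.
- by move=> u v [uv _]; apply: val_inj.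
move=> u; have [u1 u2] := unitsP u.
have uu : (val u).1 \is a GRing.unit by apply/unitrP; exists (val u).2.
by exists (FinRing.unit R uu); apply: units_inj.
Qed.

Lemma card_units_F3 : #|[set: units 'F_3]| = 2%N.
Proof.
rewrite -(card_isog (units_isog 'F_3)) card_finField_unit card_Fp //.
Qed.

Definition mx2 (R : pzRingType) (a b c d : R) : 'M[R]_2 :=
  \matrix_(i < 2, j < 2)
    if i == 0 then (if j == 0 then a else b) else (if j == 0 then c else d).

Lemma mx2M (R : pzRingType) (a b c d a' b' c' d' : R) :
  mx2 a b c d * mx2 a' b' c' d' =
  mx2 (a * a' + b * c') (a * b' + b * d') (c * a' + d * c') (c * b' + d * d').
Proof.
apply/matrixP => i j; rewrite !mxE !big_ord_recl big_ord0 !mxE /= addr0.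
by do 2!case: ifP.
Qed.

Lemma mx2_1 (R : pzRingType) : 1 = mx2 1 0 0 1 :> 'M[R]_2.
Proof.
by apply/matrixP => -[[|[]] //= ?] [[|[]] //= ?]; rewrite !mxE.
Qed.

(** [x] is a root of X^2 + X + 1, hence of order 3, and [y] swaps the two basis vectors. *)
Lemma units_M2F2_generators : exists x y : units 'M['F_2]_2,
  [/\ #[x]%g = 3, y \notin <[x]>%g, (y ^+ 2 = 1)%g & (x ^ y = x^-1)%g].
Proof.
have xP (w := (mx2 0 1 1 1 : 'M['F_2]_2, mx2 1 1 1 0 : 'M['F_2]_2)) :
    (w.1 * w.2 == 1) && (w.2 * w.1 == 1).
  by apply/andP; split; apply/eqP; rewrite mx2_1 mx2M; congr (mx2 _ _ _ _); apply/eqP.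
have yP (w := (mx2 0 1 1 0 : 'M['F_2]_2, mx2 0 1 1 0 : 'M['F_2]_2)) :
    (w.1 * w.2 == 1) && (w.2 * w.1 == 1).
  by apply/andP; split; apply/eqP; rewrite mx2_1 mx2M; congr (mx2 _ _ _ _); apply/eqP.
pose x : units 'M['F_2]_2 := Units xP; pose y : units 'M['F_2]_2 := Units yP.
have x3 : (x ^+ 3 = 1)%g.
  apply: units_inj; rewrite units_valX /= !exprS expr0 mulr1 !mx2M [RHS]mx2_1.
  by congr (mx2 _ _ _ _); apply/eqP.
have y2 : (y ^+ 2 = 1)%g.
  apply: units_inj; rewrite units_valX /= !exprS expr0 mulr1 !mx2M [RHS]mx2_1.
  by congr (mx2 _ _ _ _); apply/eqP.
have xy : (x ^ y = x^-1)%g.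
  by apply: units_inj; rewrite /= !mx2M; congr (mx2 _ _ _ _); apply/eqP.
have nx1 : x <> 1%g.
  by move/(congr1 (fun u : units 'M['F_2]_2 => (val u).1 0 0)); rewrite /= mx2_1 !mxE.
have ox : #[x]%g = 3.
  by apply: nt_prime_order => //; apply/eqP.
exists x, y; split=> //; apply/negP => /cycleP[i yi]; apply: nx1.
move: xy; rewrite yi conjgE -expgS expgSr mulKg => xV.
have xx : (x * x = 1)%g by rewrite {1}xV mulVg.
by rewrite -x3 expgS expg2 xx mulg1.
Qed.

Lemma card_units_M2F2 : #|[set: units 'M['F_2]_2]| = 6%N.
Proof.
rewrite -(card_isog (units_isog _)).
by have := card_GL_2 'F_2; rewrite card_Fp.
Qed.

End RingUnits.

(* [(((d, a), b), c)] is the matrix [[d, a, c], [0, d, b], [0, 0, d]]. *)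
Definition heis2 : Type := ('F_2 * 'F_2 * 'F_2 * 'F_2)%type.

HB.instance Definition _ := Finite.on heis2.
HB.instance Definition _ := GRing.Zmodule.on heis2.

Section HeisenbergRing.

Local Open Scope ring_scope.

Implicit Types u v w : heis2.

Lemma heis2_ext u v : u.1.1.1 = v.1.1.1 -> u.1.1.2 = v.1.1.2 ->
  u.1.2 = v.1.2 -> u.2 = v.2 -> u = v.
Proof. by case: u => [[[? ?] ?] ?]; case: v => [[[? ?] ?] ?] /= -> -> -> ->. Qed.

Definition heis2_one : heis2 := (1, 0, 0, 0).

Definition heis2_mul u v : heis2 :=
  let: (d, a, b, c) := u in let: (d', a', b', c') := v in
  (d * d', d * a' + a * d', d * b' + b * d', d * c' + a * b' + c * d').

Lemma heis2_mulA : associative heis2_mul.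
Proof.
move=> [[[d a] b] c] [[[d' a'] b'] c'] [[[d'' a''] b''] c''] /=.
by congr (_, _, _, _); ring.
Qed.

Lemma heis2_mul1x : left_id heis2_one heis2_mul.
Proof. by move=> [[[d a] b] c] /=; congr (_, _, _, _); ring. Qed.

Lemma heis2_mulx1 : right_id heis2_one heis2_mul.
Proof. by move=> [[[d a] b] c] /=; congr (_, _, _, _); ring. Qed.

Lemma heis2_mulDl : left_distributive heis2_mul +%R.
Proof.
move=> [[[d a] b] c] [[[d' a'] b'] c'] [[[d'' a''] b''] c''] /=.
apply: heis2_ext => /=; ring.
Qed.

Lemma heis2_mulDr : right_distributive heis2_mul +%R.
Proof.
move=> [[[d a] b] c] [[[d' a'] b'] c'] [[[d'' a''] b''] c''] /=.
apply: heis2_ext => /=; ring.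
Qed.

HB.instance Definition _ := GRing.Zmodule_isPzRing.Build heis2
  heis2_mulA heis2_mul1x heis2_mulx1 heis2_mulDl heis2_mulDr.

(** The units are the elements with diagonal entry 1; the other three entries are free. *)
Lemma card_units_heis2 : #|[set: units heis2]| = 8%N.
Proof.
have P (t : 'F_2 * 'F_2 * 'F_2)
    (w := ((1, t.1.1, t.1.2, t.2) : heis2,
           (1, - t.1.1, - t.1.2, t.1.1 * t.1.2 - t.2) : heis2)) :
    (w.1 * w.2 == 1) && (w.2 * w.1 == 1).
  by case: t @w => [[a b] c] /=; apply/andP; split; apply/eqP;
    apply: heis2_ext => /=; ring.
rewrite cardsT -[8%N]/(2 * 2 * 2)%N.
have <- : #|{: 'F_2 * 'F_2 * 'F_2}| = (2 * 2 * 2)%N by rewrite !card_prod !card_Fp.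
pose coords (u : units heis2) : 'F_2 * 'F_2 * 'F_2 :=
  let: (_, a, b, c) := (val u).1 in (a, b, c).
apply/esym/(@bij_eq_card _ _ (fun t => Units (P t)))/(Bijective (g := coords)).
  by case=> [[a b] c].
move=> u; apply: units_inj; rewrite /= /coords; have [] := unitsP u.
case: (val u).1 => [[[d a] b] c]; case: (val u).2 => [[[d' a'] b'] c'].
move/(congr1 (fun w : heis2 => w.1.1.1)) => /= dd _.
suff -> : d = 1 by [].
by case: d dd => [[|[|[]]]] // ?; rewrite ?mul0r // => _; apply: val_inj.
Qed.

Lemma units_heis2_isog : [set: units heis2] \isog [set: 'D_8].
Proof.
(* [x] is the unipotent Jordan block, of order 4, and [y] a transvection inverting it; each is given
   with its inverse. *)
have xP (w := ((1, 1, 1, 0) : heis2, (1, 1, 1, 1) : heis2)) :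
    (w.1 * w.2 == 1) && (w.2 * w.1 == 1) by [].
have yP (w := ((1, 1, 0, 0) : heis2, (1, 1, 0, 0) : heis2)) :
    (w.1 * w.2 == 1) && (w.2 * w.1 == 1) by [].
pose x : units heis2 := Units xP; pose y : units heis2 := Units yP.
have ox : #[x]%g = 4.
  have x4 : (x ^+ 4 = 1)%g by apply/eqP.
  have : (#[x]%g %| 2 ^ 2)%N by rewrite order_dvdn x4.
  case/dvdn_pfactor => // m m2 om; rewrite om; move: m2; rewrite leq_eqVlt.
  case/predU1P => [-> //|m1]; have : (x ^+ 2 != 1)%g by [].
  by rewrite -order_dvdn om (@dvdn_exp2l 2 m 1).
apply: (@isog_dihedral _ _ x y 4); rewrite ?inE ?card_units_heis2 //; last by apply/eqP.
  apply/negP => /cycleP[i yi].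
  have : (x * y != y * x)%g by [].
  by rewrite yi -expgS -expgSr eqxx.
by apply/eqP.
Qed.

End HeisenbergRing.

(** * Matching the holomorphs with unit groups and dihedral products *)

Section Conclusion.
Local Open Scope group_scope.

(** With [c] the involution of the first factor, [(c, x)] has order 6 and [(1, y)] inverts it. This
    serves for Hol(Z_6). *)
Lemma dihedral12_isog (gT hT : finGroupType) (x y : hT) :
    #|gT| = 2 -> #|hT| = 6 -> #[x] = 3 -> y ^+ 2 = 1 -> x ^ y = x^-1 ->
  setX [set: gT] [set: hT] \isog [set: 'D_12].
Proof.
move=> cg ch ox y2 xy.
have [c c1] : exists c : gT, c != 1.
  have : 1 < #|[set: gT]| by rewrite cardsT cg.
  by rewrite cardG_gt1 => /trivgPn[c _ c1]; exists c.
have x1 : x != 1 by rewrite -order_eq1 ox.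
have x2 : x ^+ 2 != 1 by rewrite -order_dvdn ox.
have x3 : x ^+ 3 = 1 by rewrite -ox expg_order.
have c2 : c ^+ 2 = 1 by rewrite -cg -cardsT expg_cardG ?inE.
have pX (i : nat) : ((c, x) : gT * hT) ^+ i = (c ^+ i, x ^+ i).
  by elim: i => // i IH; rewrite !expgS IH.
have oX : #[(c, x) : gT * hT] = 6.
  have : #[(c, x) : gT * hT] \in divisors 6.
    rewrite -dvdn_divisors // order_dvdn pX (expgM c 2 3) c2 expg1n.
    by rewrite (expgM x 3 2) x3 expg1n.
  rewrite !inE; case/or4P=> /eqP oX //; move: (expg_order ((c, x) : gT * hT));
    rewrite oX pX => -[/eqP cX /eqP xX]; move: cX xX.
  - by rewrite !expg1 (negPf x1).
  - by rewrite (negPf x2).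
  by rewrite expgS c2 mulg1 (negPf c1).
apply: (@isog_dihedral _ _ (c, x) (1, y) 6); rewrite ?inE //.
- by rewrite cardsX !cardsT cg ch.
- apply/negP => /cycleP[i]; rewrite pX => -[_ yi].
  move: xy; rewrite yi conjgE -expgS expgSr mulKg => xV; case/negP: x2.
  by rewrite expg2 {1}xV mulVg.
- by apply: (congr2 pair); rewrite ?mulg1.
apply: (congr2 pair) => //; apply: (etrans (conjg1 c)).
by apply/eqP; rewrite eq_sym eq_invg_mul -expg2 c2.
Qed.

End Conclusion.

Lemma isog_card2 (gT rT : finGroupType) (G : {group gT}) (H : {group rT}) :
  #|G| = 2 -> #|H| = 2 -> G \isog H.
Proof. by move=> cG cH; rewrite isog_cyclic_card ?prime_cyclic ?cG ?cH. Qed.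

Lemma isog_card1 (gT rT : finGroupType) (G : {group gT}) (H : {group rT}) :
  #|G| = 1 -> #|H| = 1 -> G \isog H.
Proof.
move=> cG cH; rewrite isog_cyclic_card ?cG ?cH.
  by rewrite (card1_trivg cH) cyclic1.
by rewrite (card1_trivg cG) cyclic1.
Qed.

Lemma HolZ_units n : 0 < n -> n %| 12 ->
  exists R : finPzRingType, HolZ n \isog [set: units R].
Proof.
have [x [y [ox nxy y2 xy]]] := units_M2F2_generators.
have M2D : [set: units 'M['F_2]_2] \isog [set: 'D_6].
  by apply: (@isog_dihedral _ _ x y 3); rewrite ?inE ?card_units_M2F2.
move=> n_gt0; rewrite dvdn_divisors // !inE.
case/predU1P => [->|]; [|case/predU1P => [->|]; [|case/predU1P => [->|]; [|
  case/predU1P => [->|]; [|case/predU1P => [->|/eqP->]]]]].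
- exists 'F_2; apply: isog_trans (units_isog 'F_2).
  by apply: isog_card1; rewrite ?card_HolZ // card_finField_unit card_Fp.
- by exists 'F_3; apply: isog_card2; rewrite ?card_HolZ ?card_units_F3.
- exists 'M['F_2]_2; apply: isog_trans (HolZ_isog_dihedral _ _) _ => //.
  by rewrite isog_sym.
- exists heis2; apply: isog_trans (HolZ_isog_dihedral _ _) _ => //.
  by rewrite isog_sym units_heis2_isog.
- exists ('F_3 * 'M['F_2]_2)%type; apply: isog_trans (HolZ_isog_dihedral _ _) _ => //.
  rewrite isog_sym; apply: isog_trans (units_prod_isog _ _) _.
  by apply: (@dihedral12_isog _ _ x y); rewrite -?cardsT ?card_units_F3 ?card_units_M2F2.
exists (heis2 * 'M['F_2]_2)%type; apply: isog_trans HolZ12_isog _.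
rewrite isog_sym; apply: isog_trans (units_prod_isog _ _) _.
exact: isog_setX units_heis2_isog M2D.
Qed.

Lemma HolZ_dihedral n : 0 < n -> n %| 12 ->
  exists (r : nat) (k : 'I_r -> nat), (forall i, 0 < k i) /\
    HolZ n \isog [set: {dffun forall i : 'I_r, dihedral (k i)}].
Proof.
move=> n_gt0 n12.
have [n1|n_neq1] := eqVneq n 1%N.
  exists 0%N, (fun _ => 1%N); split=> //.
  apply: isog_card1; first by rewrite card_HolZ // n1.
  apply/eqP; rewrite -trivg_card1 -subG1; apply/subsetP => h _; rewrite inE.
  by apply/eqP/ffunP => -[].
have one k : 0 < k -> HolZ n \isog [set: dihedral k] ->
    exists (r : nat) (k : 'I_r -> nat), (forall i, 0 < k i) /\
    HolZ n \isog [set: {dffun forall i : 'I_r, dihedral (k i)}].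
  move=> k_gt0 nk; exists 1%N, (fun _ => k); split=> //.
  exact: isog_trans nk (dffun1_isog (fun _ => dihedral k)).
have two : totient n = 2 -> HolZ n \isog [set: dihedral n].
  have n_gt1 : 1 < n by rewrite ltn_neqAle eq_sym n_neq1.
  move=> tn; rewrite isog_sym; apply: isog_trans (dihedral_isog n_gt1) _.
  rewrite isog_sym HolZ_isog_dihedral //.
  by rewrite ltn_neqAle n_gt1 andbT; apply/eqP => n2; move: tn; rewrite -n2.
move: n12; rewrite dvdn_divisors // !inE (negPf n_neq1) /=.
have [n2 _|n_neq2 /=] := eqVneq n 2%N.
  apply: (one 1%N) => //; apply: isog_card2; rewrite ?card_HolZ ?n2 //.
  by rewrite cardsT card_ord.
have [n12 _|n_neq12] := eqVneq n 12; last first.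
  by rewrite orbF => n346; apply: (one n n_gt0 (two _)); case/or3P: n346 => /eqP->.
exists 2, (fun i : 'I_2 => if i == ord0 then 4 else 3); split=> [i|]; first by case: ifP.
rewrite n12; apply: isog_trans HolZ12_isog _.
exact: (dffun2_isog (fun i : 'I_2 => dihedral (if i == ord0 then 4 else 3))).
Qed.

Theorem theorem1p3 (n : nat) (hn : 0 < n) :
  [<-> n %| 12;
       exists R : finPzRingType, HolZ n \isog [set: units R];
       elementary_abelian2 (units (polyZmod n));
       exists (r : nat) (k : 'I_r -> nat),
         (forall i, 0 < k i) /\
         HolZ n \isog [set: {dffun forall i : 'I_r, dihedral (k i)}];
       #|HolZ n| %| 48].
Proof.
(* The case n = 1 is settled apart, since ['Z_n] has [n] elements only for n > 1. *)
have dvd1 (P : Prop) : (1 < n -> P -> n %| 12) -> P -> n %| 12.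
  move=> nP p; have [n_gt1|n_le1] := ltnP 1 n; first exact: nP.
  by rewrite (_ : n = 1) //; apply/eqP; rewrite eqn_leq n_le1.
have fromUnits : (exists R : finPzRingType, HolZ n \isog [set: units R]) -> n %| 12.
  by apply: dvd1 => n_gt1 [R]; exact: HolZ_units_dvd12.
have fromPoly : elementary_abelian2 (units (polyZmod n)) -> n %| 12.
  apply: dvd1 => n_gt1 [_]; rewrite /polyZmod ifN ?gtn_eqF // => sq1.
  apply: polyZ_units_dvd12 => // p q pq.
  have P : ((p, q).1 * (p, q).2 == 1)%R && ((p, q).2 * (p, q).1 == 1)%R.
    by rewrite /= [(q * p)%R]mulrC pq eqxx.
  by have /(congr1 (fun u => (val u).1)) := sq1 (Units P).
have toPoly : n %| 12 -> elementary_abelian2 (units (polyZmod n)).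
  rewrite /polyZmod => n12; case: eqVneq => [_|n_neq1].
    have triv (u v : units 'M[int]_0) : u = v.
      by apply: units_inj; apply/matrixP => -[].
    by split=> *; apply: triv.
  have n_gt1 : 1 < n by rewrite ltn_neqAle eq_sym n_neq1.
  split=> [u v|u]; apply: units_inj; first by rewrite /= mulrC.
  by have [uv _] := unitsP u; apply: (polyZ_units_sqr n_gt1 n12 uv).
tfae.
- exact: HolZ_units.
- by move/fromUnits.
- by move/fromPoly/(HolZ_dihedral hn).
- case=> r [k [k_gt0 iso]]; have : n %| 12.
    by apply: (dvd1 _ _ iso) => n_gt1; apply: HolZ_dihedral_dvd12.
  rewrite card_HolZ // dvdn_divisors // !inE.
  by do ![case/predU1P => [->|] //]; move/eqP->.
(* The order is n phi(n), so [n] divides 48; for the divisors 8, 16, 24 and 48, those not dividing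
   12, n phi(n) does not divide 48. *)
rewrite card_HolZ // => n48; have := dvdn_trans (dvdn_mulr _ (dvdnn n)) n48.
rewrite dvdn_divisors // !inE; move: n48.
by do ![move=> n48 /predU1P[nE|]; first (by move: n48; rewrite nE); move: n48];
  move=> n48 /eqP nE; move: n48; rewrite nE.
Qed.
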